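(* Let $\nu>0$, $d\in\{2,3\}$, and let $\omega,\hat\omega$ be kernels satisfying the kernel assumptions (K1)–(K4) stated in the context, with $\beta\in(-1,1)$ the exponent in (K4). For a $2\pi$-periodic mean-zero vector field $\bm f$ on $\Omega=(-\pi,\pi)^d$ and $N\ge1$, let $(\bm u^N,p^N)$ be the Fourier spectral approximation of the $2\pi$-periodic mean-zero solution of the local Stokes system $-\nu\Delta\bm u+\nabla p=\bm f$, $-\nabla\cdot\bm u=0$ in $\Omega$, and for $\delta>0$ let $(\bm u_\delta^N,p_\delta^N)$ be the Fourier spectral approximation of the $2\pi$-periodic mean-zero solution of the nonlocal Stokes system $-\nu\mathcal L_\delta\bm u_\delta+\mathcal G_\delta p_\delta=\bm f$, $-\mathcal D_\delta\bm u_\delta=0$ in $\Omega$. Then there is a constant $C$ independent of $\delta$, $N$ and $\bm f$ such that $$\|\bm u_\delta^N-\bm u^N\|_{[L^2(\Omega)]^d}\le C\delta^2\|\bm f^N\|_{[L^2(\Omega)]^d}$$ and $$\|p_\delta^N-p^N\|_{L^2(\Omega)}\le C\delta^{\min\{2,1+\eta\}}\|\bm f^N\|_{[H^\eta(\Omega)]^d}\qquad\text{for }\eta\ge-\beta,$$ where $\bm f^N$ is the truncation of $\bm f$ to the same Fourier modes.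
   Context: Periodic functions (more generally periodic distributions) on $\Omega=(-\pi,\pi)^d$ with zero mean are identified with their Fourier coefficients: $g(\bm x)=(2\pi)^{-d}\sum_{\bm\xi\in\mathbb Z^d,\bm\xi\ne0}\widehat g(\bm\xi)e^{i\bm\xi\cdot\bm x}$, $\widehat g(\bm\xi)=\int_\Omega g(\bm x)e^{-i\bm\xi\cdot\bm x}d\bm x$. For mean-zero $g$ and $s\in\mathbb R$, $\|g\|_{H^s(\Omega)}^2=(2\pi)^{-d}\sum_{\bm\xi\neq0}|\bm\xi|^{2s}|\widehat g(\bm\xi)|^2$ and $\|\cdot\|_{L^2}=\|\cdot\|_{H^0}$. The Fourier spectral approximation of a solution is its truncation (projection) to the Fourier modes with wave number $|\bm\xi|\le N$. Kernels. $\omega,\hat\omega:(0,\infty)\to[0,\infty)$ are measurable, vanish on $(1,\infty)$, and for $\delta>0$ one sets $\underline\omega_\delta(r)=\delta^{-(d+2)}\omega(r/\delta)$, $\hat\omega_\delta(r)=\delta^{-(d+1)}\hat\omega(r/\delta)$. Assumptions: (K1) $\frac12\int_{\mathbb R^d}\underline\omega_\delta(|\bm x|)|\bm x|^2d\bm x=d$; (K2) $\int_{\mathbb R^d}\hat\omega_\delta(|\bm x|)|\bm x|d\bm x=d$; (K3) $r^{d-1}\hat\omega(r)$ is nonincreasing for $r\in(0,1)$; (K4) there are $\epsilon\in(0,1]$, $c>0$ and $\beta\in(-1,1)$ with $\hat\omega(r)=c\,r^{-d-\beta}$ for $r\in(0,\epsilon)$. Operators. With $\vec\omega_\delta(\bm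 x)=\hat\omega_\delta(|\bm x|)\bm x/|\bm x|$, $\mathcal L_\delta\bm u(\bm x)=\int_{\mathbb R^d}\underline\omega_\delta(|\bm x-\bm y|)(\bm u(\bm y)-\bm u(\bm x))d\bm y$, $\mathcal G_\delta p(\bm x)=\int_{\mathbb R^d}\vec\omega_\delta(\bm y-\bm x)(p(\bm y)-p(\bm x))d\bm y$, $\mathcal D_\delta\bm u(\bm x)=\int_{\mathbb R^d}\vec\omega_\delta(\bm y-\bm x)\cdot(\bm u(\bm y)+\bm u(\bm x))d\bm y$ (principal value where needed). In Fourier variables they act, and are extended to periodic distributions, by $\widehat{\mathcal L_\delta\bm u}=-\lambda_\delta\widehat{\bm u}$, $\widehat{\mathcal G_\delta p}=i\bm b_\delta\widehat p$, $\widehat{\mathcal D_\delta\bm u}=i\bm b_\delta^T\widehat{\bm u}$, where $\lambda_\delta(\bm\xi)=\int_{|\bm s|\le\delta}\underline\omega_\delta(|\bm s|)(1-\cos(\bm\xi\cdot\bm s))d\bm s$ and $\bm b_\delta(\bm\xi)=\int_{|\bm s|\le\delta}\hat\omega_\delta(|\bm s|)\frac{\bm s}{|\bm s|}\sin(\bm\xi\cdot\bm s)d\bm s$. Solutions are understood in this Fourier (distributional) sense; under these assumptions the nonlocal system has a unique mean-zero periodic solution. The constant $C$ may depend on $d,\nu,\omega,\hat\omega$. *)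

(* Defs.v *)
From HB Require Import structures.
From mathcomp Require Import all_boot all_order all_algebra.
From mathcomp Require Import all_classical all_reals all_analysis.
From mathcomp Require Import complex.

Set Implicit Arguments.
Unset Strict Implicit.
Unset Printing Implicit Defensive.

Import Order.TTheory GRing.Theory Num.Theory.
Import numFieldNormedType.Exports.

Local Open Scope classical_set_scope.
Local Open Scope ring_scope.
Local Open Scope complex_scope.

(** R^n is [n.-tuple (measurableTypeR R)] with its product sigma-algebra, and
  [lebesgue_tuple R n] is the n-fold product of [lebesgue_measure]. *)

Section tuple_cons_measure.
Context {R : realType} {n : nat}.
Notation tup k := (k.-tuple (measurableTypeR R)).
Variable m : {sigma_finite_measure set (tup n) -> \bar R}.

Definition tuple_cons (x : measurableTypeR R * tup n) : tup n.+1 :=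
  [tuple of x.1 :: x.2].

Lemma measurable_tuple_cons : measurable_fun setT tuple_cons.
Proof. exact: measurable_cons. Qed.

HB.instance Definition _ :=
  isMeasurableFun.Build _ _ _ _ tuple_cons measurable_tuple_cons.

Definition tuple_cons_measure : set (tup n.+1) -> \bar R :=
  pushforward (lebesgue_measure \x m)%E tuple_cons.

Let tuple_cons_measure0 : tuple_cons_measure set0 = 0%E.
Proof. exact: measure0. Qed.

Let tuple_cons_measure_ge0 A : (0 <= tuple_cons_measure A)%E.
Proof. exact: measure_ge0. Qed.

Let tuple_cons_measure_sigma_additive :
  semi_sigma_additive tuple_cons_measure.
Proof. exact: measure_semi_sigma_additive. Qed.

HB.instance Definition _ := isMeasure.Build _ _ _ tuple_cons_measure
  tuple_cons_measure0 tuple_cons_measure_ge0 tuple_cons_measure_sigma_additive.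

Let tuple_cons_measure_sigma_finite : sigma_finite setT tuple_cons_measure.
Proof.
have /sigma_finiteP[F [FT ndF Foo]] := sigma_finiteT (@lebesgue_measure R).
have /sigma_finiteP[G [GT ndG Goo]] := sigma_finiteT m.
exists (fun k => [set t : tup n.+1 |
    F k (thead t) /\ G k [tuple of behead t]]).
  apply/seteqP; split => // t _.
  have [i _ Fit] : (\bigcup_i F i) (thead t) by rewrite -FT.
  have [j _ Gjt] : (\bigcup_i G i) [tuple of behead t] by rewrite -GT.
  exists (maxn i j) => //; split.
    by move: Fit; apply/subsetPset/ndF/leq_maxl.
  by move: Gjt; apply/subsetPset/ndG/leq_maxr.
move=> k; have [mF Fk] := Foo k; have [mG Gk] := Goo k; split.
  apply: measurableI; rewrite -[X in measurable X]setTI.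
    exact: measurable_tnth.
  exact: (@measurable_behead _ (measurableTypeR R)).
rewrite /tuple_cons_measure /pushforward (_ : _ @^-1` _ = F k `*` G k).
  by rewrite product_measure1E// lte_mul_pinfty// ge0_fin_numE.
have beheadK (x : measurableTypeR R * tup n) :
  [tuple of behead (tuple_cons x)] = x.2 by exact: val_inj.
by apply/seteqP; split => x /=; rewrite beheadK.
Qed.

HB.instance Definition _ := Measure_isSigmaFinite.Build _ _ _
  tuple_cons_measure tuple_cons_measure_sigma_finite.

End tuple_cons_measure.

Fixpoint lebesgue_tuple (R : realType) (n : nat) :
    {sigma_finite_measure set (n.-tuple (measurableTypeR R)) -> \bar R} :=
  if n is n'.+1 then tuple_cons_measure (lebesgue_tuple R n')
  else \d_([tuple] : 0.-tuple (measurableTypeR R)).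

Lemma lebesgue_tuple_box (R : realType) (n : nat)
    (A : 'I_n -> set (measurableTypeR R)) : (forall i, measurable (A i)) ->
  lebesgue_tuple R n [set x | forall i, A i (tnth x i)] =
  (\prod_(i < n) lebesgue_measure (A i))%E.
Proof.
elim: n A => [|n IHn] A mA /=.
  by rewrite big_ord0 diracE mem_set// => -[].
rewrite big_ord_recl -IHn; last by move=> i; exact: mA.
rewrite -product_measure1E//; last first.
  rewrite (_ : [set x | _] =
    \bigcap_(i in [set: 'I_n]) ((@tnth n R ^~ i) @^-1` A (lift ord0 i))).
    apply: fin_bigcap_measurable => [|i _]; first exact: finite_finset.
    by rewrite -[X in measurable X]setTI; exact: measurable_tnth.
  by apply/seteqP; split => x /= Hx i => [_|]; exact: Hx.
rewrite /tuple_cons_measure /pushforward; congr (_ _).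
apply/seteqP; split => -[x t] /=.
  move=> H; split; first exact: (H ord0).
  by move=> i; have := H (lift ord0 i); rewrite /tuple_cons tnthS.
move=> [Hx Ht] i; case: (unliftP ord0 i) => [j ->|-> //].
by rewrite /tuple_cons tnthS; exact: Ht.
Qed.

Section euclidean.
Context {R : realType} {n : nat}.
Implicit Types x y : n.-tuple (measurableTypeR R).

Definition dot x y : R := \sum_(i < n) (tnth x i : R) * (tnth y i : R).

Definition enorm x : R := Num.sqrt (dot x x).

End euclidean.

(** A kernel on (0, +oo) is a total function whose values at nonpositive
  arguments are irrelevant: it is only evaluated at [|x| / delta], and [x = 0]
  is negligible. *)

Section kernels.
Context {R : realType}.

Definition scaled_omega (d : nat) (omega : R -> R) (delta r : R) : R :=
  (delta ^+ (d + 2))^-1 * omega (r / delta).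

Definition scaled_omega_hat (d : nat) (omegah : R -> R) (delta r : R) : R :=
  (delta ^+ (d + 1))^-1 * omegah (r / delta).

Definition is_kernel (omega : R -> R) : Prop :=
  [/\ measurable_fun (`]0, +oo[%classic : set R) omega,
      forall r, 0 < r -> 0 <= omega r &
      forall r, 1 < r -> omega r = 0].

Record kernel_assumptions (d : nat) (omega omegah : R -> R) (beta : R) : Prop :=
{ kernel_omega : is_kernel omega ;
  kernel_omega_hat : is_kernel omegah ;
  kernel_moment2 : forall delta : R, 0 < delta ->
    ((2^-1)%:E * \int[lebesgue_tuple R d]_x
       (scaled_omega d omega delta (enorm x) * enorm x ^+ 2)%:E = d%:R%:E)%E ;
  kernel_moment1 : forall delta : R, 0 < delta ->
    (\int[lebesgue_tuple R d]_x
       (scaled_omega_hat d omegah delta (enorm x) * enorm x)%:E = d%:R%:E)%E ;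
  kernel_nonincreasing : forall r1 r2 : R, 0 < r1 -> r1 <= r2 -> r2 < 1 ->
    r2 ^+ d.-1 * omegah r2 <= r1 ^+ d.-1 * omegah r1 ;
  kernel_exponent : -1 < beta < 1 ;
  kernel_power : exists eps c : R, [/\ 0 < eps <= 1, 0 < c &
    forall r : R, 0 < r < eps -> omegah r = c * r `^ (- d%:R - beta)] }.

End kernels.

(** A 2 pi-periodic (complex) distribution on R^d is identified with the family
  of its Fourier coefficients [\int g(x) exp(- i xi . x) dx], xi in Z^d; the
  families so obtained are exactly those of at most polynomial growth. *)

Section fourier.
Context {R : realType} {d : nat}.

Definition freq := 'rV[int]_d.
Definition scalar_coefs := freq -> R[i].
Definition vector_coefs := freq -> 'cV[R[i]]_d.

Definition wave (xi : freq) : d.-tuple (measurableTypeR R) :=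
  [tuple (xi 0 i)%:~R : R | i < d].

Definition wavenumber (xi : freq) : R := enorm (wave xi).

Definition coord_coefs (u : vector_coefs) (j : 'I_d) : scalar_coefs :=
  fun xi => u xi j 0.

Definition mean_zero_distr (g : scalar_coefs) : Prop :=
  g 0 = 0 /\ exists (K : R) (m : nat), forall xi,
    Normc.normc (g xi) <= K * (1 + wavenumber xi) ^+ m.

Definition mean_zero_vdistr (u : vector_coefs) : Prop :=
  forall j, mean_zero_distr (coord_coefs u j).

Definition truncate (V : zmodType) (N : R) (g : freq -> V) : freq -> V :=
  fun xi => if wavenumber xi <= N then g xi else 0.

(* Sobolev norms are +oo on distributions which are not in H^s. *)
Definition Hs_norm2 (s : R) (g : scalar_coefs) : \bar R :=
  (((2 * pi) ^+ d)^-1%:E * \esum_(xi in [set xi : freq | xi != 0%R])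
     (wavenumber xi `^ (2 * s) * Normc.normc (g xi) ^+ 2)%:E)%E.

Definition Hs_norm (s : R) (g : scalar_coefs) : \bar R :=
  (Hs_norm2 s g `^ 2^-1)%E.

Definition Hs_vnorm (s : R) (u : vector_coefs) : \bar R :=
  ((\sum_(j < d) Hs_norm2 s (coord_coefs u j)) `^ 2^-1)%E.

Definition L2_norm (g : scalar_coefs) : \bar R := Hs_norm 0 g.
Definition L2_vnorm (u : vector_coefs) : \bar R := Hs_vnorm 0 u.

(* Fourier multipliers with symbols [i b(xi)] and [i b(xi)^T], shared by the
  local ([b(xi) = xi]) and nonlocal ([b = b_symbol]) operators. *)
Definition mult_grad (b : freq -> 'cV[R]_d) (p : scalar_coefs) : vector_coefs :=
  fun xi => \col_j ('i * (b xi j 0)%:C * p xi).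

Definition mult_div (b : freq -> 'cV[R]_d) (u : vector_coefs) : scalar_coefs :=
  fun xi => 'i * \sum_(j < d) (b xi j 0)%:C * u xi j 0.

Definition wave_symbol (xi : freq) : 'cV[R]_d := \col_j (xi 0 j)%:~R.

Definition laplacian (u : vector_coefs) : vector_coefs :=
  fun xi => - (wavenumber xi ^+ 2)%:C *: u xi.
Definition gradient : scalar_coefs -> vector_coefs := mult_grad wave_symbol.
Definition divergence : vector_coefs -> scalar_coefs := mult_div wave_symbol.

Definition lambda_symbol (omega : R -> R) (delta : R) (xi : freq) : R :=
  \int[lebesgue_tuple R d]_(s in [set s | enorm s <= delta])
    (scaled_omega d omega delta (enorm s) * (1 - cos (dot (wave xi) s))).

Definition b_symbol (omegah : R -> R) (delta : R) (xi : freq) : 'cV[R]_d :=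
  \col_j \int[lebesgue_tuple R d]_(s in [set s | enorm s <= delta])
    (scaled_omega_hat d omegah delta (enorm s) *
     ((tnth s j : R) / enorm s) * sin (dot (wave xi) s)).

Definition nl_laplacian (omega : R -> R) (delta : R) (u : vector_coefs) :
  vector_coefs := fun xi => - (lambda_symbol omega delta xi)%:C *: u xi.
Definition nl_gradient (omegah : R -> R) (delta : R) :
  scalar_coefs -> vector_coefs := mult_grad (b_symbol omegah delta).
Definition nl_divergence (omegah : R -> R) (delta : R) :
  vector_coefs -> scalar_coefs := mult_div (b_symbol omegah delta).

Definition stokes_solution (lap : vector_coefs -> vector_coefs)
    (grad : scalar_coefs -> vector_coefs) (div : vector_coefs -> scalar_coefs)
    (nu : R) (f u : vector_coefs) (p : scalar_coefs) : Prop :=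
  [/\ mean_zero_vdistr u, mean_zero_distr p,
      forall xi, - (nu%:C *: lap u xi) + grad p xi = f xi &
      forall xi, - div u xi = 0].

Definition local_stokes := stokes_solution laplacian gradient divergence.

Definition nonlocal_stokes (omega omegah : R -> R) (delta : R) :=
  stokes_solution (nl_laplacian omega delta) (nl_gradient omegah delta)
    (nl_divergence omegah delta).

End fourier.

Arguments freq : clear implicits.
Arguments scalar_coefs : clear implicits.
Arguments vector_coefs : clear implicits.

(* Main.v *)
From HB Require Import structures.
Require Import Defs.
From mathcomp Require Import all_boot all_order all_algebra.
From mathcomp Require Import all_classical all_reals all_analysis.
From mathcomp Require Import measurable_realfun complex ring lra.

(** On a nonzero mode xi put x = |xi|^2. Both Stokes systems are diagonal in
  Fourier variables. Rotation invariance of the kernels makes the gradient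
  symbol parallel to xi, b(xi) = kappa xi, so the local and nonlocal systems
  differ by two positive scalars only: with lambda the symbol of minus the
  nonlocal Laplacian, lambda ud = x u and kappa pd = p. Moreover the Fourier
  coefficient f splits orthogonally into the solenoidal part nu x u and the
  part i p xi, so nu x |u| <= |f| and |xi| |p| <= |f| ([mode_comparison]).
  Everything is thus reduced to two relative errors, with rho = delta |xi|:
  - |x / lambda - 1| <= 5 rho^2 ([lambda_error]);
  - |1 / kappa - 1| <= C delta^min(2,1+eta) |xi|^(1+eta) for eta >= -beta
    ([gradient_factor_error]).

  For rho <= 1 both follow from Taylor's formula and the moment conditions.
  For rho >= 1 one needs lower bounds on lambda and kappa, which are obtained
  without polar coordinates or special functions.

  Lower bound on lambda ([cos_symbol_lower]). The function
  L(z) = int W(|s|) (1 - cos(z.s)) ds is radial in z, and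
  L(z - y) <= 2 L(z) + 2 L(y). In dimension at least two, any
  length up to 2|z| is the length of a difference of two vectors of length |z|;
  choosing the length 1/delta gives L(z) >= L(1/delta)/4, and the Taylor bound
  applies to L(1/delta).

  Lower bound on kappa ([sin_symbol_lower]). With W(r) the rescaled kernel of
  the gradient divided by r, |xi|^2 kappa = int W(|s|) (xi.s) sin(xi.s) ds is
  the derivative at t = 1 of L(t xi). A dilation gives
  L(t xi) = int t^(-d) W(|s|/t) (1 - cos(xi.s)) ds, and the integrand is
  nondecreasing in t because r^d W(r) is nonincreasing. On the ball where W is
  a pure power the weight t^(-d) W(r/t) equals t^(1+beta) W(r), so the derivative
  is at least (1 + beta) times the part of L(xi) coming from that ball; on a
  ball of radius comparable to 1/|xi| this part is of the order required,
  namely |xi|^2 rho^(beta-1).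

  The geometric input is that reflections preserve Lebesgue measure on R^n and
  dilations scale it. Both are instances of one form of the uniqueness of Haar
  measure ([lebesgue_tuple_linear]), proved by applying Tonelli's theorem twice
  to the function h(x) g(x + T y). *)

Set Implicit Arguments.
Unset Strict Implicit.
Unset Printing Implicit Defensive.

Import Order.TTheory GRing.Theory Num.Theory.
Import numFieldNormedType.Exports.

Local Open Scope classical_set_scope.
Local Open Scope ring_scope.

(** * Lebesgue measure on R^n: translations and linear maps *)

Section lebesgue_invariance.
Context {R : realType}.
Notation vec n := (n.-tuple (measurableTypeR R)).

Definition vadd n (x y : vec n) : vec n :=
  [tuple ((tnth x i : R) + (tnth y i : R) : measurableTypeR R) | i < n].

Definition vscale n (a : R) (x : vec n) : vec n :=
  [tuple (a * (tnth x i : R) : measurableTypeR R) | i < n].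

Lemma tnth_vadd n (x y : vec n) i :
  tnth (vadd x y) i = (tnth x i : R) + (tnth y i : R) :> R.
Proof. by rewrite tnth_mktuple. Qed.

Lemma tnth_vscale n a (x : vec n) i : tnth (vscale a x) i = a * (tnth x i : R) :> R.
Proof. by rewrite tnth_mktuple. Qed.

Lemma measurable_coord d (X : measurableType d) n (f : X -> vec n) (i : 'I_n) :
  measurable_fun setT f -> measurable_fun setT (fun x => tnth (f x) i : R).
Proof. by move=> /measurable_fun_tnthP/(_ i). Qed.

Lemma measurable_vadd d (X : measurableType d) n (f g : X -> vec n) :
  measurable_fun setT f -> measurable_fun setT g ->
  measurable_fun setT (fun x => vadd (f x) (g x)).
Proof.
move=> mf mg; apply/measurable_fun_tnthP => i.
rewrite (_ : _ \o _ = fun x => (tnth (f x) i : R) + (tnth (g x) i : R)); last first.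
  by apply/funext => x /=; rewrite tnth_vadd.
by apply: measurable_funD; exact: measurable_coord.
Qed.

Lemma measurable_vscale d (X : measurableType d) n (a : X -> R) (f : X -> vec n) :
  measurable_fun setT a -> measurable_fun setT f ->
  measurable_fun setT (fun x => vscale (a x) (f x)).
Proof.
move=> ma mf; apply/measurable_fun_tnthP => i.
rewrite (_ : _ \o _ = fun x => a x * (tnth (f x) i : R)); last first.
  by apply/funext => x /=; rewrite tnth_vscale.
by apply: measurable_funM => //; exact: measurable_coord.
Qed.

Lemma measurable_dot d (X : measurableType d) n (f g : X -> vec n) :
  measurable_fun setT f -> measurable_fun setT g ->
  measurable_fun setT (fun x => dot (f x) (g x)).
Proof.
move=> mf mg; rewrite /dot.
by apply: measurable_sum => i; apply: measurable_funM; exact: measurable_coord.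
Qed.

Lemma measurable_enorm d (X : measurableType d) n (f : X -> vec n) :
  measurable_fun setT f -> measurable_fun setT (fun x => enorm (f x)).
Proof.
move=> mf; rewrite /enorm.
apply: (@measurableT_comp _ _ _ _ _ _ (@Num.sqrt R)); last exact: measurable_dot.
exact: continuous_measurable_fun (@sqrt_continuous R).
Qed.

(** Both measures agree on half-open intervals. *)
Lemma lebesgue_shift1 (a : R) (g : R -> \bar R) : measurable_fun setT g ->
  (forall x, 0 <= g x)%E ->
  (\int[lebesgue_measure]_x g (x + a)%R = \int[lebesgue_measure]_x g x)%E.
Proof.
move=> mg g0.
have mS : measurable_fun setT (fun x : measurableTypeR R => (x : R) + a : measurableTypeR R).
  by apply: measurable_funD.
pose S_mix := isMeasurableFun.Build _ _ _ _ _ mS.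
pose S : {mfun measurableTypeR R >-> measurableTypeR R} := HB.pack (fun x : measurableTypeR R => (x : R) + a : measurableTypeR R) S_mix.
have -> : (\int[lebesgue_measure]_x g (x + a)%R =
   \int[pushforward (@lebesgue_measure R) S]_x g x)%E.
  by rewrite ge0_integral_pushforward.
apply: eq_measure_integral => A mA _ /=.
apply/esym/lebesgue_measure_unique => // X [[u v] _ <-].
rewrite -[RHS]/(lebesgue_measure ((fun x : R => x + a) @^-1` [set` `]u, v]])).
rewrite (_ : _ @^-1` _ = [set` `]u - a, v - a]]); last first.
  by apply/seteqP; split => x /=; rewrite !in_itv /= ltrBlDr lerBrDr.
rewrite !lebesgue_measure_itv /= !lte_fin ltrD2r.
by case: ifP => // _; rewrite -!EFinB; congr (_%:E); ring.
Qed.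

Lemma lebesgue_tupleS n (g : vec n.+1 -> \bar R) : measurable_fun setT g ->
  (forall x, 0 <= g x)%E ->
  (\int[lebesgue_tuple R n.+1]_x g x =
   \int[lebesgue_measure]_x \int[lebesgue_tuple R n]_t g (tuple_cons (x, t)))%E.
Proof.
move=> mg g0.
rewrite [LHS](_ : _ = \int[lebesgue_measure \x lebesgue_tuple R n]_z
   g (tuple_cons z))%E; last first.
  rewrite /= /tuple_cons_measure ge0_integral_pushforward//.
rewrite fubini_tonelli1//.
exact: (measurableT_comp mg (@measurable_tuple_cons _ _)).
Qed.

Lemma lebesgue_tuple_shift n (a : vec n) (g : vec n -> \bar R) :
  measurable_fun setT g -> (forall x, 0 <= g x)%E ->
  (\int[lebesgue_tuple R n]_x g (vadd x a) = \int[lebesgue_tuple R n]_x g x)%E.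
Proof.
elim: n a g => [|n IHn] a g mg g0.
  by apply: eq_integral => x _; rewrite [in LHS]tuple0 [in RHS]tuple0.
have maddr m (b : vec m) : measurable_fun setT (fun x => vadd x b).
  exact: measurable_vadd (@measurable_id _ _ _) (@measurable_cst _ _ _ _ _ _).
rewrite !lebesgue_tupleS//; last exact: (measurableT_comp mg (maddr _ _)).
pose a' := [tuple of behead a].
have consD x t : vadd (tuple_cons (x, t)) a =
    tuple_cons ((x : R) + (tnth a ord0 : R) : measurableTypeR R, vadd t a').
  apply: eq_from_tnth => i; rewrite tnth_vadd /tuple_cons /=.
  case: (unliftP ord0 i) => [j|] ->; last by rewrite !tnth0.
  by rewrite !tnthS tnth_vadd; congr (_ + _); rewrite [in LHS](tuple_eta a) tnthS.
under eq_integral do (under eq_integral do rewrite consD).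
have mcons : measurable_fun setT (@tuple_cons R n) by exact: measurable_tuple_cons.
transitivity (\int[lebesgue_measure]_x \int[lebesgue_tuple R n]_t
    g (tuple_cons ((x + (tnth a ord0 : R))%R, t)))%E.
  apply: eq_integral => x _.
  rewrite (IHn a' (fun t => g (tuple_cons ((x + (tnth a ord0 : R))%R, t))))//.
  do 2 apply: measurableT_comp => //.
rewrite (@lebesgue_shift1 _ (fun x => \int[lebesgue_tuple R n]_t g (tuple_cons (x, t)))%E)//.
  apply: (measurable_fun_fubini_tonelli_F (fun z => g (tuple_cons z))) => //.
  exact: measurableT_comp.
by move=> x; exact: integral_ge0.
Qed.

(** The measure sending g to the integral of g o T is translation invariant,
  hence proportional to Lebesgue measure; h measures the proportionality factor.
  Integrating h(x) g(x + T y) first in y gives the left-hand side, by invariance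
  under the shift of y by S x. Integrating first in x, after shifting x by
  - T y, and then in y gives the right-hand side, where evenness of h turns
  h(x - T y) into h(T (y - S x)). *)
Lemma lebesgue_tuple_linear n (T S : vec n -> vec n) (g h : vec n -> \bar R) :
  measurable_fun setT T -> (forall x y, T (vadd x y) = vadd (T x) (T y)) ->
  measurable_fun setT S -> cancel S T ->
  measurable_fun setT g -> (forall x, 0 <= g x)%E ->
  measurable_fun setT h -> (forall x, 0 <= h x)%E ->
  (forall x, h (vscale (-1) x) = h x) ->
  ((\int[lebesgue_tuple R n]_x h x) * (\int[lebesgue_tuple R n]_x g (T x)) =
   (\int[lebesgue_tuple R n]_x h (T x)) * (\int[lebesgue_tuple R n]_x g x))%E.
Proof.
move=> mT TD mS ST mg g0 mh h0 hN.
set mu := lebesgue_tuple R n.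
have mgT : measurable_fun setT (g \o T) by exact: measurableT_comp.
have mhT : measurable_fun setT (h \o T) by exact: measurableT_comp.
have mid := @measurable_id _ (vec n) setT.
have maddr (b : vec n) : measurable_fun setT (fun x => vadd x b).
  exact: measurable_vadd mid (@measurable_cst _ _ _ _ _ _).
have maddl (b : vec n) : measurable_fun setT (fun x => vadd b x).
  exact: measurable_vadd (@measurable_cst _ _ _ _ _ _) mid.
have mdiff : measurable_fun setT (fun z : vec n * vec n => vadd z.1 (vscale (-1) (T z.2))).
  apply: measurable_vadd; first exact: measurable_fst.
  apply: measurable_vscale; first exact: measurable_cst.
  exact: measurableT_comp mT measurable_snd.
have vaddC (x y : vec n) : vadd x y = vadd y x.
  by apply: eq_from_tnth => i; rewrite !tnth_vadd addrC.
have Gge0 : (0 <= \int[mu]_x g (T x))%E by exact: integral_ge0.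
have Hge0 : (0 <= \int[mu]_x h (T x))%E by exact: integral_ge0.
transitivity (\int[mu]_x \int[mu]_y (h x * g (vadd x (T y))))%E.
  rewrite -ge0_integralZr//; apply: eq_integral => x _.
  rewrite ge0_integralZl//; last first.
    exact: measurableT_comp mg (measurableT_comp (maddl _) mT).
  congr (_ * _)%E.
  (* As x = T (S x), the function y |-> g (x + T y) is a shift of g o T by S x. *)
  rewrite -[LHS](@lebesgue_tuple_shift _ (S x) (g \o T)) => [||y]; [|by []|exact: g0].
  by apply: eq_integral => y _; rewrite /= TD ST vaddC.
apply: etrans.
  apply: (fubini_tonelli (fun z : vec n * vec n => h z.1 * g (vadd z.1 (T z.2)))%E).
  apply: emeasurable_funM; first exact: measurableT_comp mh measurable_fst.
  apply: (measurableT_comp mg); apply: measurable_vadd; first exact: measurable_fst.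
  exact: measurableT_comp mT measurable_snd.
  by move=> z; rewrite mule_ge0.
have vaddK (x y : vec n) : vadd (vadd x (vscale (-1) y)) y = x.
  by apply: eq_from_tnth => i; rewrite !tnth_vadd tnth_vscale mulN1r subrK.
transitivity (\int[mu]_y \int[mu]_x (h (vadd x (vscale (-1) (T y))) * g x))%E.
  apply: eq_integral => y _ /=.
  rewrite -[LHS](@lebesgue_tuple_shift _ (vscale (-1) (T y)) (fun x => h x * g (vadd x (T y)))%E).
  - by apply: eq_integral => x _ /=; rewrite vaddK.
  - by apply: emeasurable_funM => //; exact: measurableT_comp mg (maddr _).
  - by move=> x; rewrite mule_ge0.
apply: etrans.
  apply/esym/(fubini_tonelli (fun z : vec n * vec n => h (vadd z.1 (vscale (-1) (T z.2))) * g z.1)%E).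
  apply: emeasurable_funM; last exact: measurableT_comp mg measurable_fst.
  exact: measurableT_comp mh mdiff.
  by move=> z; rewrite mule_ge0.
rewrite -ge0_integralZl//; apply: eq_integral => x _ /=.
rewrite ge0_integralZr//; last first.
  apply: (measurableT_comp mh); apply: measurable_vadd => //.
  exact: measurable_vscale mT.
congr (_ * _)%E.
rewrite -[RHS](@lebesgue_tuple_shift _ (S (vscale (-1) x)) (h \o T)) => [||y]; [|by []|exact: h0].
apply: eq_integral => y _; rewrite /= TD ST -hN; congr h.
apply: eq_from_tnth => i; rewrite !(tnth_vadd, tnth_vscale); ring.
Qed.

End lebesgue_invariance.

(** * Reflections, dilations, balls and spheres *)

Section euclidean_algebra.
Context {R : realType} {n : nat}.
Notation vec := (n.-tuple (measurableTypeR R)).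
Implicit Types x y v : vec.

Lemma dotC x y : dot x y = dot y x.
Proof. by apply: eq_bigr => i _; rewrite mulrC. Qed.

Lemma dotDl x y v : dot (vadd x y) v = dot x v + dot y v.
Proof.
by rewrite /dot -big_split; apply: eq_bigr => i _; rewrite tnth_vadd mulrDl.
Qed.

Lemma dotDr x y v : dot v (vadd x y) = dot v x + dot v y.
Proof. by rewrite dotC dotDl !(dotC v). Qed.

Lemma dotZl a x v : dot (vscale a x) v = a * dot x v.
Proof.
by rewrite /dot mulr_sumr; apply: eq_bigr => i _; rewrite tnth_vscale mulrA.
Qed.

Lemma dotZr a x v : dot v (vscale a x) = a * dot v x.
Proof. by rewrite dotC dotZl (dotC v). Qed.

Lemma dot_ge0 x : 0 <= dot x x.
Proof. by apply: sumr_ge0 => i _; rewrite -expr2 sqr_ge0. Qed.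

Lemma enorm_ge0 x : 0 <= enorm x.
Proof. exact: sqrtr_ge0. Qed.

Lemma sqr_enorm x : enorm x ^+ 2 = dot x x.
Proof. by rewrite sqr_sqrtr// dot_ge0. Qed.

Lemma enorm_vscale a x : enorm (vscale a x) = `|a| * enorm x.
Proof. by rewrite /enorm dotZl dotZr mulrA -expr2 sqrtrM ?sqr_ge0// sqrtr_sqr. Qed.

Lemma coord_sqr_le i x : (tnth x i : R) ^+ 2 <= dot x x.
Proof.
rewrite /dot (bigD1 i)//= -expr2 lerDl; apply: sumr_ge0 => j _.
by rewrite -expr2 sqr_ge0.
Qed.

Lemma dot_eq0 x i : dot x x = 0 -> tnth x i = 0 :> R.
Proof.
move=> x0; apply/eqP; rewrite -sqrf_eq0 eq_le sqr_ge0 andbT -x0.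
exact: coord_sqr_le.
Qed.

Lemma cauchy_schwarz x y : dot x y ^+ 2 <= dot x x * dot y y.
Proof.
have [y0|y0] := eqVneq (dot y y) 0.
  rewrite y0 mulr0 /dot big1 ?expr0n// => i _.
  by rewrite (@dot_eq0 y i y0) mulr0.
have ypos : 0 < dot y y by rewrite lt_neqAle eq_sym y0 dot_ge0.
have := dot_ge0 (vadd (vscale (dot y y) x) (vscale (- dot x y) y)).
rewrite dotDl !dotDr !dotZl !dotZr (dotC y x) => H.
by rewrite -subr_ge0 -(pmulr_rge0 _ ypos); move: H; lra.
Qed.

Lemma ler_norm_dot x y : `|dot x y| <= enorm x * enorm y.
Proof.
rewrite -(@ler_pXn2r _ 2)// ?nnegrE ?mulr_ge0 ?enorm_ge0//.
by rewrite exprMn !sqr_enorm real_normK ?num_real// cauchy_schwarz.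
Qed.

(** The reflection in the hyperplane orthogonal to v. It is the identity when
  v = 0, since division by zero yields zero. *)
Definition reflect_along v x : vec :=
  vadd x (vscale (- (2 * dot v x / dot v v)) v).

Lemma dot_reflect v x y : dot y (reflect_along v x) =
  dot y x - 2 * dot v x / dot v v * dot y v.
Proof. by rewrite dotDr dotZr mulNr. Qed.

Lemma reflectD v x y :
  reflect_along v (vadd x y) = vadd (reflect_along v x) (reflect_along v y).
Proof.
apply: eq_from_tnth => i.
rewrite !(tnth_vadd, tnth_vscale) dotDr; ring.
Qed.

Lemma reflectK v : cancel (reflect_along v) (reflect_along v).
Proof.
move=> x; apply: eq_from_tnth => i.
rewrite !(tnth_vadd, tnth_vscale) dotDr dotZr.
have [v0|v0] := eqVneq (dot v v) 0; first by rewrite (@dot_eq0 v i v0); ring.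
by field.
Qed.

Lemma reflect_adjoint v x y :
  dot (reflect_along v x) y = dot x (reflect_along v y).
Proof. rewrite dotC !dot_reflect (dotC y x) (dotC y v) (dotC x v); ring. Qed.

Lemma dot_reflect2 v x : dot (reflect_along v x) (reflect_along v x) = dot x x.
Proof. by rewrite reflect_adjoint reflectK. Qed.

Lemma enorm_reflect v x : enorm (reflect_along v x) = enorm x.
Proof. by rewrite /enorm dot_reflect2. Qed.

Definition vsub x y : vec := vadd x (vscale (-1) y).

(** Reflections act transitively on spheres: this is all of the rotation
  group that is needed. *)
Lemma reflect_sub x y : dot x x = dot y y -> reflect_along (vsub x y) x = y.
Proof.
move=> xy.
have Ev : dot (vsub x y) (vsub x y) = 2 * dot (vsub x y) x.
  rewrite /vsub !(dotDl, dotDr, dotZl, dotZr) -xy (dotC y x); ring.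
apply: eq_from_tnth => i; rewrite !(tnth_vadd, tnth_vscale) -Ev.
have [v0|v0] := eqVneq (dot (vsub x y) (vsub x y)) 0.
  have := @dot_eq0 _ i v0; rewrite !(tnth_vadd, tnth_vscale) => E.
  by rewrite E mulr0 addr0; move: E; lra.
by rewrite divff//; ring.
Qed.

Lemma measurable_reflect v : measurable_fun setT (reflect_along v).
Proof.
have mid := @measurable_id _ vec setT.
have -> : reflect_along v = fun x => vadd x (vscale (- (2 / dot v v) * dot v x) v).
  by apply/funext => x; rewrite /reflect_along; congr (vadd _ (vscale _ _)); ring.
have ma : measurable_fun setT (fun x : vec => - (2 / dot v v) * dot v x).
  apply: measurable_funM => //.
  exact: measurable_dot (@measurable_cst _ _ _ _ _ _) mid.
exact: measurable_vadd mid (measurable_vscale ma (@measurable_cst _ _ _ _ _ _)).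
Qed.

End euclidean_algebra.

Section volumes.
Context {R : realType} {n : nat}.
Notation vec := (n.-tuple (measurableTypeR R)).
Notation mu := (lebesgue_tuple R n).

Definition eball (a : R) : set vec := [set x | enorm x <= a].

Lemma measurable_eball a : measurable (eball a).
Proof.
rewrite (_ : eball a = setT `&` (fun x : vec => enorm x) @^-1` `]-oo, a]%classic).
  exact: (measurable_enorm (@measurable_id _ vec setT)).
by apply/seteqP; split => x; rewrite /eball /= in_itv /=; [split|case].
Qed.

Lemma measurable_esphere a : measurable ([set s | enorm s = a] : set vec).
Proof.
rewrite (_ : [set _ | _] = setT `&` (fun s : vec => enorm s) @^-1` [set a]).
  exact: (measurable_enorm (@measurable_id _ vec setT)).
by rewrite setTI.
Qed.

Definition ebox (a b : R) : set vec := [set x | forall i, `[a, b]%classic (tnth x i : R)].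

Lemma measurable_ebox a b : measurable (ebox a b).
Proof.
rewrite (_ : ebox a b = \bigcap_(i in [set: 'I_n]) (setT `&` (@tnth n R ^~ i) @^-1` `[a, b]%classic)).
  apply: fin_bigcap_measurable => [|i _]; first exact: finite_finset.
  exact: measurable_tnth.
apply/seteqP; split => x H i; last by have [_] := H i I.
by move=> _; split => //; exact: H.
Qed.

Lemma ebox_volume a b : a <= b -> mu (ebox a b) = ((b - a) ^+ n)%:E.
Proof.
move=> ab; rewrite /ebox (@lebesgue_tuple_box R n (fun=> `[a, b]%classic))//.
rewrite (eq_bigr (fun=> (b - a)%:E)); last first.
  move=> i _; rewrite lebesgue_measure_itv /= lte_fin -EFinB.
  case: ifPn => // /negP; move/negP; rewrite -leNgt => ba.
  by congr (_%:E); lra.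
by rewrite prodEFin prodr_const card_ord.
Qed.

Lemma eball_volume_ub a : 0 <= a -> (mu (eball a) <= ((2 * a) ^+ n)%:E)%E.
Proof.
move=> a0; rewrite (_ : 2 * a = a - (- a)); last by ring.
rewrite -ebox_volume; last by lra.
apply: le_measure; rewrite ?inE; [exact: measurable_eball|exact: measurable_ebox|].
move=> x /= xa i; rewrite /= in_itv /=.
rewrite -ler_norml -(@ler_pXn2r _ 2)// ?nnegrE// real_normK ?num_real//.
apply: le_trans (coord_sqr_le i x) _.
by rewrite -sqr_enorm ler_pXn2r// ?nnegrE ?enorm_ge0.
Qed.

(** The cube of side a / (n + 1) at the origin fits in the ball. The
  denominator n + 1, rather than sqrt n, avoids square roots and the case n = 0. *)
Lemma eball_volume_lb a : 0 <= a -> (((a / n.+1%:R) ^+ n)%:E <= mu (eball a))%E.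
Proof.
move=> a0; rewrite -[X in X ^+ n]subr0 -ebox_volume; last by rewrite divr_ge0.
apply: le_measure; rewrite ?inE; [exact: measurable_ebox|exact: measurable_eball|].
move=> x /= xa; rewrite /eball /= -(@ler_pXn2r _ 2)// ?nnegrE ?enorm_ge0//.
rewrite sqr_enorm /dot.
apply: (@le_trans _ _ (\sum_(i < n) (a / n.+1%:R) ^+ 2)).
  apply: ler_sum => i _; have := xa i; rewrite /= in_itv /= -expr2 => /andP[x0 xn].
  by rewrite ler_pXn2r// nnegrE (le_trans x0).
rewrite sumr_const card_ord -[X in X *+ n]mulr1 -mulrnAr expr_div_n -mulrA.
rewrite ler_piMr ?sqr_ge0// mulrC ler_pdivrMr ?exprn_gt0// mul1r.
by rewrite -natrX ler_nat; apply: leq_trans (leqnSn n) _; exact: leq_pmulr.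
Qed.

Lemma integral_set_indic (A : set vec) (T : vec -> vec) : measurable A ->
  measurable_fun setT T ->
  (\int[mu]_x (\1_A (T x))%:E = mu (T @^-1` A))%E.
Proof.
move=> mA mT.
have mTA : measurable (T @^-1` A) by rewrite -[X in measurable X]setTI; exact: mT.
rewrite -[X in _ = mu X]setIT -integral_indic//.
Qed.

(** The unit ball is invariant under the reflection and has positive finite
  volume, so the proportionality factor of [lebesgue_tuple_linear] is 1. *)
Lemma lebesgue_reflect v (g : vec -> \bar R) : measurable_fun setT g ->
  (forall x, 0 <= g x)%E -> (\int[mu]_x g (reflect_along v x) = \int[mu]_x g x)%E.
Proof.
move=> mg g0; have mB := measurable_eball 1.
have := @lebesgue_tuple_linear R n (reflect_along v) (reflect_along v) g
  (fun x => (\1_(eball 1) x)%:E) (measurable_reflect v) (reflectD v)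
  (measurable_reflect v) (@reflectK _ _ v) mg g0.
rewrite (integral_set_indic mB (measurable_reflect v)).
rewrite (integral_set_indic mB (@measurable_id _ _ _)).
rewrite preimage_id (_ : _ @^-1` _ = eball 1); last first.
  by apply/seteqP; split => x; rewrite /eball /= enorm_reflect.
have lb := @eball_volume_lb 1 ler01; have ub := @eball_volume_ub 1 ler01.
have fB : mu (eball 1) \is a fin_num.
  by rewrite ge0_fin_numE ?measure_ge0// (le_lt_trans ub)// ltry.
rewrite -(fineK fB) in lb *.
have Bpos : 0 < fine (mu (eball 1)).
  rewrite lee_fin in lb; apply: lt_le_trans lb.
  by rewrite exprn_gt0// divr_gt0// ltr0n.
move=> H.
have {}H : ((fine (mu (eball 1)))%:E * \int[mu]_x g (reflect_along v x) =
  (fine (mu (eball 1)))%:E * \int[mu]_x g x)%E.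
  apply: H.
  - exact/measurable_EFinP/measurable_indic.
  - by move=> x; rewrite lee_fin.
  - move=> x; congr (_%:E).
    rewrite !indicE; congr (_%:R); congr (nat_of_bool _).
    by apply/idP/idP; rewrite !inE /eball /= enorm_vscale normrN1 mul1r.
have {}H := congr1 (fun z => ((fine (mu (eball 1)))^-1%:E * z)%E) H.
by move: H; rewrite /= !muleA -EFinM mulVf ?gt_eqF// !mul1e.
Qed.

(** Here the factor of [lebesgue_tuple_linear] is computed on a cube, whose
  preimage is again a cube. *)
Lemma lebesgue_dilate t (g : vec -> \bar R) : 0 < t -> measurable_fun setT g ->
  (forall x, 0 <= g x)%E ->
  (\int[mu]_x g (vscale t x) = ((t ^+ n)^-1)%:E * \int[mu]_x g x)%E.
Proof.
move=> t0 mg g0; have mB := measurable_ebox (-1) 1.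
have msc (s : R) : measurable_fun setT (@vscale R n s).
  by apply: measurable_vscale => //; exact: measurable_cst.
have := @lebesgue_tuple_linear R n (vscale t) (vscale t^-1) g
  (fun x => (\1_(ebox (-1) 1) x)%:E) (msc t) _ (msc t^-1) _ mg g0.
rewrite (integral_set_indic mB (msc t)) (integral_set_indic mB (@measurable_id _ _ _)).
rewrite preimage_id (_ : _ @^-1` _ = ebox (- t^-1) t^-1); last first.
  have E (y : R) : (-1 <= t * y <= 1) = (- t^-1 <= y <= t^-1).
    have E1 : (-1 <= t * y) = (- t^-1 <= y).
      by rewrite -(ler_pM2l t0 (- t^-1)) mulrN divff// gt_eqF.
    have E2 : (t * y <= 1) = (y <= t^-1).
      by rewrite -(ler_pM2l t0 y) divff// gt_eqF.
    by rewrite E1 E2.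
  by apply/seteqP; split => x /= H i; have := H i;
    rewrite /= !in_itv /= tnth_vscale E.
have ti0 : 0 < t^-1 by rewrite invr_gt0.
rewrite !ebox_volume; [|lra|lra].
move=> H.
have {}H : (((1 - -1) ^+ n)%:E * \int[mu]_x g (vscale t x) =
  ((t^-1 - - t^-1) ^+ n)%:E * \int[mu]_x g x)%E.
  apply: H.
  - move=> x y; apply: eq_from_tnth => i.
    by rewrite !(tnth_vadd, tnth_vscale); ring.
  - move=> x; apply: eq_from_tnth => i.
    by rewrite !tnth_vscale mulrA divff ?mul1r// gt_eqF.
  - exact/measurable_EFinP/measurable_indic.
  - by move=> x; rewrite lee_fin.
  - move=> x; congr (_%:E); rewrite !indicE; congr (_%:R); congr (nat_of_bool _).
    apply/idP/idP; rewrite !inE => B i; have := B i; rewrite /= !in_itv /= tnth_vscale; lra.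
have {}H := congr1 (fun z => (((1 - -1) ^+ n)^-1%:E * z)%E) H.
have two : (1 - -1 : R) != 0 by rewrite opprK; lra.
move: H; rewrite /= !muleA -!EFinM mulVf ?expf_neq0// mul1e => ->.
congr ((_%:E) * _)%E; rewrite -exprVn -exprMn -exprVn; congr (_ ^+ _).
by field; rewrite gt_eqF.
Qed.

Lemma Rintegral_reflect v (g : vec -> R) : measurable_fun setT g ->
  \int[mu]_x g (reflect_along v x) = \int[mu]_x g x.
Proof.
move=> mg; rewrite /Rintegral; congr fine.
have mg' : measurable_fun setT (EFin \o g) by exact/measurable_EFinP.
rewrite [LHS]integralE [RHS]integralE; congr (_ - _)%E.
  rewrite -[RHS](@lebesgue_reflect v) => [||x]; last exact: funepos_ge0.
    by apply: eq_integral => x _; rewrite !funeposE.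
  exact: measurable_funepos.
rewrite -[RHS](@lebesgue_reflect v) => [||x]; last exact: funeneg_ge0.
  by apply: eq_integral => x _; rewrite !funenegE.
exact: measurable_funeneg.
Qed.

End volumes.

(** Tonelli's theorem: each line parallel to the first axis meets the sphere in
  at most two points. *)
Lemma esphere_null (R : realType) n (a : R) :
  lebesgue_tuple R n.+1 [set x | enorm x = a] = 0%E.
Proof.
set S := [set x | _].
have mS : measurable S by exact: measurable_esphere.
have mI : measurable_fun setT (fun x => (\1_S x : R)%:E) by exact/measurable_EFinP/measurable_indic.
have mId : measurable_fun setT (fun z => (\1_S (@tuple_cons R n z) : R)%:E).
  exact: measurableT_comp mI (@measurable_tuple_cons _ _).
rewrite -[LHS]/((lebesgue_tuple R n.+1) (id @^-1` S)).
rewrite -(@integral_set_indic R n.+1 S id)//.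
rewrite (@lebesgue_tupleS R n (fun x => (\1_S x)%:E))//.
have F := @fubini_tonelli _ _ _ _ _ (@lebesgue_measure R) (lebesgue_tuple R n)
  (fun z => (\1_S (@tuple_cons R n z) : R)%:E) mId.
rewrite [LHS]F; last by move=> z; rewrite lee_fin.
rewrite (eq_integral (cst 0%E)) ?integral0// => t _.
transitivity (\int[@lebesgue_measure R]_x
    (\1_[set x : R | tuple_cons (x : measurableTypeR R, t) \in S] x : R)%:E)%E.
  apply: eq_integral => x _; rewrite /= !indicE; congr (_%:R%:E); congr nat_of_bool.
  by apply/idP/idP; rewrite !inE /= inE.
set D := [set x | _].
have cD : countable D.
  apply: finite_set_countable.
  apply: (@sub_finite_set _ _ [set Num.sqrt (a ^+ 2 - dot t t); - Num.sqrt (a ^+ 2 - dot t t)]).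
    move=> x; rewrite /D /= inE /S /= => xa.
    have : a ^+ 2 = x ^+ 2 + dot t t.
      rewrite -xa sqr_enorm /dot big_ord_recl /= !tnth0 -expr2; congr (_ + _).
      by apply: eq_bigr => i _; rewrite !tnthS.
    move=> ->; rewrite addrK sqrtr_sqr.
    have [x0|x0] := lerP 0 (x : R); [left|right]; rewrite /= ?(ger0_norm x0) ?(ltr0_norm x0) ?opprK//.
  by rewrite finite_setU; split; exact: finite_set1.
have mD : measurable (D : set (measurableTypeR R)).
  by apply: countable_measurable => // x _; exact: measurable_set1.
rewrite integral_indic// setIT; exact: countable_lebesgue_measure0.
Qed.

(** * Trigonometric inequalities *)

Section trigonometric_inequalities.
Context {R : realType}.
Implicit Types x y h t : R.

Lemma le_of_derive_ge0 (f df : R -> R) x : (forall y, is_derive y 1 f (df y)) ->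
  (forall y, 0 <= y -> 0 <= df y) -> 0 <= x -> f 0 <= f x.
Proof.
move=> fdf df0 x0.
have [|c] := @MVT_segment _ f df 0 x x0 (fun y _ => fdf y).
  by apply: derivable_within_continuous => y _; have [] := fdf y.
rewrite in_itv /= => /andP[c0 _] E; rewrite -subr_ge0 E subr0.
by rewrite mulr_ge0// df0.
Qed.

Lemma sin_le_id x : 0 <= x -> sin x <= x.
Proof.
move=> x0; have := @le_of_derive_ge0 (fun y => y - sin y) (fun y => 1 - cos y) x.
rewrite sin0 subr0 subr_ge0; apply => // y _; by rewrite subr_ge0 cos_le1.
Qed.

Lemma norm_sin_le x : `|sin x| <= `|x|.
Proof.
wlog x0 : x / 0 <= x.
  move=> H; have [/H//|x0] := lerP 0 x.
  by have := H (- x); rewrite sinN !normrN; apply; rewrite oppr_ge0 ltW.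
have := @le_of_derive_ge0 (fun y => sin y + y) (fun y => cos y + 1) x.
rewrite sin0 addr0 (ger0_norm x0) ler_norml sin_le_id// andbT => H.
suff : 0 <= sin x + x by lra.
by apply: H => // y _; have := cos_geN1 y; lra.
Qed.

Lemma one_sub_cos_le x : 1 - cos x <= x ^+ 2 / 2.
Proof.
wlog x0 : x / 0 <= x.
  move=> H; have [/H//|x0] := lerP 0 x.
  by rewrite -cosN -sqrrN H// oppr_ge0 ltW.
have := @le_of_derive_ge0 (fun y => cos y + y ^+ 2 / 2) (fun y => y - sin y) x.
rewrite cos0 expr0n /= mul0r addr0 => H.
suff : 1 <= cos x + x ^+ 2 / 2 by lra.
apply: H => // [y|y y0]; last by rewrite subr_ge0 sin_le_id.
apply: is_derive_eq; rewrite /GRing.scale /=.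
by field.
Qed.

Lemma sin_ge_cubic x : 0 <= x -> x - x ^+ 3 / 6 <= sin x.
Proof.
move=> x0.
have := @le_of_derive_ge0 (fun y => sin y - y + y ^+ 3 / 6)
  (fun y => cos y - 1 + y ^+ 2 / 2) x.
rewrite sin0 expr0n /= mul0r subr0 addr0 => H.
suff : 0 <= sin x - x + x ^+ 3 / 6 by lra.
apply: H => // [y|y y0]; last by have := one_sub_cos_le y; lra.
apply: is_derive_eq; rewrite /GRing.scale /=; by field.
Qed.

Lemma one_sub_cos_ge x : x ^+ 2 / 2 - x ^+ 4 / 24 <= 1 - cos x.
Proof.
wlog x0 : x / 0 <= x.
  move=> H; have [/H//|x0] := lerP 0 x.
  have := H (- x); rewrite cosN sqrrN (_ : (- x) ^+ 4 = x ^+ 4); last by ring.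
  by apply; rewrite oppr_ge0 ltW.
have := @le_of_derive_ge0 (fun y => - cos y - y ^+ 2 / 2 + y ^+ 4 / 24)
  (fun y => sin y - y + y ^+ 3 / 6) x.
rewrite cos0 !expr0n /= !mul0r subr0 addr0 => H.
suff : - 1 <= - cos x - x ^+ 2 / 2 + x ^+ 4 / 24 by lra.
apply: H => // [y|y y0]; last by have := sin_ge_cubic y0; lra.
apply: is_derive_eq; rewrite /GRing.scale /=; by field.
Qed.

Lemma mul_sin_bounds x : x ^+ 2 - x ^+ 4 / 6 <= x * sin x <= x ^+ 2.
Proof.
wlog x0 : x / 0 <= x.
  move=> H; have [/H//|x0] := lerP 0 x.
  have := H (- x); rewrite sinN sqrrN (_ : (- x) ^+ 4 = x ^+ 4); last by ring.
  by rewrite mulrNN; apply; rewrite oppr_ge0 ltW.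
apply/andP; split; last by rewrite expr2 ler_wpM2l// sin_le_id.
rewrite (_ : _ - _ = x * (x - x ^+ 3 / 6)); last by field.
by rewrite ler_wpM2l// sin_ge_cubic.
Qed.

(** The cubic Taylor bound for h <= 6 and the trivial bound h + 1 beyond; a
  quadratic bound is what a finite second moment can absorb. *)
Lemma sin_sub_id h : `|h - sin h| <= h ^+ 2.
Proof.
wlog h0 : h / 0 <= h.
  move=> H; have [/H//|h0] := lerP 0 h.
  have := H (- h); rewrite sinN sqrrN -opprD normrN.
  by apply; rewrite oppr_ge0 ltW.
have h1 := sin_le_id h0; have h2 := sin_ge_cubic h0; have h3 := sin_geN1 h.
rewrite ger0_norm ?subr_ge0//.
have [h6|h6] := lerP h 6; last by nra.
have h_ : 0 <= h ^+ 2 * (6 - h) by rewrite mulr_ge0 ?sqr_ge0 ?subr_ge0.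
rewrite exprS in h2; lra.
Qed.

(** First-order Taylor expansion of t |-> cos ((1 + t) x). The remainder is
  quadratic in x as well as in t, hence integrable against a weight with finite
  second moment, which replaces a differentiation under the integral sign. *)
Lemma cos_increment t x :
  cos x - cos ((1 + t) * x) <= t * (x * sin x) + t ^+ 2 * (3 / 2 * x ^+ 2).
Proof.
rewrite mulrDl mul1r cosD; set h := t * x.
have c1 := one_sub_cos_le h; have s1 := sin_sub_id h.
have cx := cos_le1 x; have ch := cos_le1 h.
have A : cos x * (1 - cos h) <= h ^+ 2 / 2.
  apply: le_trans c1; rewrite ler_piMl// subr_ge0//.
have B : sin x * (sin h - h) <= h ^+ 2.
  apply: le_trans (ler_norm _) _; rewrite normrM distrC.
  by apply: le_trans s1; rewrite ler_piMl// sin_max.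
have -> : t * (x * sin x) = h * sin x by rewrite /h; ring.
have -> : t ^+ 2 * (3 / 2 * x ^+ 2) = 3 / 2 * h ^+ 2 by rewrite /h; by field.
lra.
Qed.

(** This is |e^(ix) - e^(iy)|^2 <= 2 |e^(ix) - 1|^2 + 2 |e^(iy) - 1|^2; the
  difference of the two sides is |e^(ix) + e^(iy) - 2|^2. *)
Lemma one_sub_cosB x y : 1 - cos (x - y) <= 2 * (1 - cos x) + 2 * (1 - cos y).
Proof.
rewrite cosB; have := cos2Dsin2 x; have := cos2Dsin2 y.
have := sqr_ge0 (cos x + cos y - 2); have := sqr_ge0 (sin x + sin y).
lra.
Qed.

End trigonometric_inequalities.

(** * Radial weights with a finite second moment *)

Section radial_weights.
Context {R : realType} {n : nat}.
Notation vec := (n.-tuple (measurableTypeR R)).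
Notation mu := (lebesgue_tuple R n).
Implicit Types (W : R -> R) (s v z y : vec) (delta : R).

Lemma Rintegral_sum (I : Type) (r : seq I) (F : I -> vec -> R) :
  (forall i, mu.-integrable setT (EFin \o F i)) ->
  \int[mu]_s (\sum_(i <- r) F i s) = \sum_(i <- r) \int[mu]_s F i s.
Proof.
move=> iF; rewrite [LHS]/Rintegral.
under eq_integral do rewrite -sumEFin.
rewrite integral_sum// (eq_bigr (fun i => (\int[mu]_s F i s)%:E)) ?sumEFin// => i _.
by rewrite fineK//; exact: (integrable_fin_num measurableT (iF i)).
Qed.

Lemma measurable_radial W (phi : R -> R) z : measurable_fun setT W ->
  measurable_fun setT phi ->
  measurable_fun setT (fun s => W (enorm s) * phi (dot z s)).
Proof.
move=> mW mphi; have mid := @measurable_id _ vec setT.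
apply: measurable_funM; first exact: measurableT_comp mW (measurable_enorm mid).
exact: measurableT_comp mphi (measurable_dot (@measurable_cst _ _ _ _ _ _) mid).
Qed.

Lemma measurable_one_sub_cos : measurable_fun setT (fun x : R => 1 - cos x).
Proof.
apply: measurable_funB => //.
exact: continuous_measurable_fun (@continuous_cos R).
Qed.

Lemma measurable_sin : measurable_fun setT (@sin R).
Proof. exact: continuous_measurable_fun (@continuous_sin R). Qed.

(** The reflection exchanging z and y preserves both the measure and |s|. *)
Lemma Rintegral_radial W (phi : R -> R) z y : measurable_fun setT W ->
  measurable_fun setT phi -> dot z z = dot y y ->
  \int[mu]_s (W (enorm s) * phi (dot z s)) =
  \int[mu]_s (W (enorm s) * phi (dot y s)).
Proof.
move=> mW mphi zy; set v := vsub z y.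
rewrite -[RHS](Rintegral_reflect v (measurable_radial y mW mphi)).
apply: eq_Rintegral => s _; rewrite enorm_reflect -reflect_adjoint.
by rewrite -(reflect_sub zy) reflectK.
Qed.

(** The rescaled Laplacian kernel, and the rescaled gradient kernel divided by
  r, both satisfy these conditions, so that one theory serves both operators. Only
  the second moment is finite: W may have a nonintegrable singularity at 0. *)
Record radial_weight W delta : Prop := RadialWeight {
  weight_measurable : measurable_fun setT W ;
  weight_ge0 : forall r, 0 <= W r ;
  weight_support : forall r, delta < r -> W r = 0 ;
  weight_integrable :
    mu.-integrable setT (fun s => (W (enorm s) * enorm s ^+ 2)%:E) }.

Definition weight_mass W : R := \int[mu]_s (W (enorm s) * enorm s ^+ 2).

Section fixed_weight.
Variables (W : R -> R) (delta : R).
Hypotheses (delta0 : 0 <= delta) (HW : radial_weight W delta).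
Let mW := weight_measurable HW.

Lemma weight_dominated (F : vec -> R) k : measurable_fun setT F ->
  (forall s, `|F s| <= k * (W (enorm s) * enorm s ^+ 2)) ->
  mu.-integrable setT (EFin \o F).
Proof.
move=> mF Fk.
apply: (@le_integrable _ _ _ mu setT measurableT _
  (fun s => k%:E * (W (enorm s) * enorm s ^+ 2)%:E)%E); first exact/measurable_EFinP.
  move=> s _; rewrite -EFinM /= lee_fin; apply: le_trans (Fk s) _; exact: ler_norm.
exact: (integrableZl measurableT _ (weight_integrable HW)).
Qed.

Lemma weight_dominated_dot (phi : R -> R) z k : measurable_fun setT phi -> 0 <= k ->
  (forall x, `|phi x| <= k * x ^+ 2) ->
  mu.-integrable setT (fun s => (W (enorm s) * phi (dot z s))%:E).
Proof.
move=> mphi k0 phik.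
apply: (@weight_dominated (fun s => W (enorm s) * phi (dot z s)) (k * dot z z)).
  exact: measurable_radial.
move=> s; rewrite normrM (ger0_norm (weight_ge0 HW _)) mulrCA ler_wpM2l ?(weight_ge0 HW)//.
apply: le_trans (phik _) _; rewrite -mulrA ler_wpM2l// sqr_enorm.
exact: cauchy_schwarz.
Qed.

Lemma integrable_sqr_dot z : mu.-integrable setT (fun s => (W (enorm s) * dot z s ^+ 2)%:E).
Proof.
apply: (@weight_dominated_dot (fun x => x ^+ 2) z 1) => // x.
by rewrite mul1r ger0_norm// sqr_ge0.
Qed.

Lemma one_sub_cos_bounds (x : R) : 0 <= 1 - cos x <= 2^-1 * x ^+ 2.
Proof. by rewrite subr_ge0 cos_le1 mulrC one_sub_cos_le. Qed.

Lemma integrable_one_sub_cos z :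
  mu.-integrable setT (fun s => (W (enorm s) * (1 - cos (dot z s)))%:E).
Proof.
apply: (@weight_dominated_dot (fun x => 1 - cos x) z 2^-1).
- exact: measurable_one_sub_cos.
- by rewrite invr_ge0.
- by move=> x; have /andP[c0 c1] := one_sub_cos_bounds x; rewrite ger0_norm.
Qed.

Lemma norm_mul_sin_le (x y : R) : `|x * sin y| <= `|x| * `|y|.
Proof. by rewrite normrM ler_wpM2l// norm_sin_le. Qed.

Lemma measurable_dot_sin v z :
  measurable_fun setT (fun s => W (enorm s) * (dot v s * sin (dot z s))).
Proof.
have mid := @measurable_id _ vec setT.
have md w : measurable_fun setT (fun s : vec => dot w s).
  exact: measurable_dot (@measurable_cst _ _ _ _ _ _) mid.
apply: measurable_funM; first exact: measurableT_comp mW (measurable_enorm mid).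
by apply: measurable_funM => //; exact: measurableT_comp measurable_sin (md z).
Qed.

Lemma integrable_dot_sin v z :
  mu.-integrable setT (fun s => (W (enorm s) * (dot v s * sin (dot z s)))%:E).
Proof.
apply: (@weight_dominated (fun s => W (enorm s) * (dot v s * sin (dot z s)))
  (enorm v * enorm z)); first exact: measurable_dot_sin.
move=> s; rewrite normrM (ger0_norm (weight_ge0 HW _)) mulrCA ler_wpM2l ?(weight_ge0 HW)//.
apply: le_trans (norm_mul_sin_le _ _) _.
rewrite expr2 mulrACA ler_pM//; exact: ler_norm_dot.
Qed.

Definition unit_vec (i : 'I_n) : vec := [tuple ((j == i)%:R : R) : measurableTypeR R | j < n].

Lemma dot_unit_vec i s : dot (unit_vec i) s = tnth s i.
Proof.
rewrite /dot (bigD1 i)//= tnth_mktuple eqxx mul1r big1 ?addr0// => j ji.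
by rewrite tnth_mktuple (negPf ji) mul0r.
Qed.

(** By rotation invariance the integral depends on z only through |z|, so it is
  the average over the n vectors |z| e_i, where the squares add up to |z|^2 |s|^2. *)
Lemma second_moment z : (0 < n)%N ->
  \int[mu]_s (W (enorm s) * dot z s ^+ 2) = weight_mass W / n%:R * dot z z.
Proof.
move=> n0; pose I z := \int[mu]_s (W (enorm s) * dot z s ^+ 2).
have nn : n%:R != 0 :> R by rewrite pnatr_eq0 -lt0n.
suff : n%:R * I z = dot z z * weight_mass W.
  by move=> H; apply: (mulfI nn); rewrite [LHS]H; field.
have -> : n%:R * I z = \sum_(i < n) I (vscale (enorm z) (unit_vec i)).
  rewrite -[n in n%:R]card_ord -sum1_card natr_sum mulr_suml; apply: eq_bigr => i _.
  rewrite mul1r; apply: (@Rintegral_radial W (fun x => x ^+ 2)) => //.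
  by rewrite dotZl dotZr dot_unit_vec tnth_mktuple eqxx mulr1 -expr2 sqr_enorm.
have -> : dot z z * weight_mass W = \int[mu]_s
    (\sum_(i < n) W (enorm s) * dot (vscale (enorm z) (unit_vec i)) s ^+ 2).
  rewrite /weight_mass -RintegralZl//; last exact: (weight_integrable HW).
  apply: eq_Rintegral => s _; rewrite -mulr_sumr mulrCA; congr (_ * _).
  rewrite (sqr_enorm s) -(sqr_enorm z) [X in _ * X]/dot mulr_sumr; apply: eq_bigr => i _.
  by rewrite dotZl dot_unit_vec exprMn expr2.
rewrite Rintegral_sum// => i; exact: integrable_sqr_dot.
Qed.

End fixed_weight.
End radial_weights.

(** * Symbols of radial weights *)

Section symbols.
Context {R : realType} {n : nat}.
Notation vec := (n.-tuple (measurableTypeR R)).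
Notation mu := (lebesgue_tuple R n).
Implicit Types (W : R -> R) (s v z y : vec) (delta : R).

Definition cos_symbol W z : R := \int[mu]_s (W (enorm s) * (1 - cos (dot z s))).

Definition sin_symbol W v z : R :=
  \int[mu]_s (W (enorm s) * (dot v s * sin (dot z s))).

Section bounds.
Variables (W : R -> R) (delta : R).
Hypotheses (n0 : (0 < n)%N) (delta0 : 0 <= delta) (HW : radial_weight (n := n) W delta).
Let m := weight_mass (n := n) W / n%:R.
Let mW := weight_measurable HW.
Let W0 := weight_ge0 HW.

(** On the support |s| <= delta, one factor (z.s)^2 is at most |z|^2 delta^2;
  this turns the Taylor remainders into multiples of the second moment. *)
Lemma weight_quartic z s :
  W (enorm s) * dot z s ^+ 4 <= dot z z * delta ^+ 2 * (W (enorm s) * dot z s ^+ 2).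
Proof.
have [sd|sd] := lerP (enorm s) delta; last by rewrite (weight_support HW sd) !mul0r mulr0.
rewrite [leRHS]mulrCA ler_wpM2l// (_ : dot z s ^+ 4 = dot z s ^+ 2 * dot z s ^+ 2); last by ring.
rewrite ler_wpM2r ?sqr_ge0//; apply: le_trans (cauchy_schwarz _ _) _.
by rewrite ler_wpM2l ?dot_ge0// -sqr_enorm ler_pXn2r// nnegrE ?enorm_ge0.
Qed.

Lemma RintegralZ_sqr_dot k z :
  \int[mu]_s (k * (W (enorm s) * dot z s ^+ 2)) = k * (m * dot z z).
Proof. by rewrite RintegralZl ?(second_moment HW)//; exact: (integrable_sqr_dot HW). Qed.

Lemma integrableZ_sqr_dot k z :
  mu.-integrable setT (EFin \o (fun s => k * (W (enorm s) * dot z s ^+ 2))).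
Proof. exact: (integrableZl measurableT k (integrable_sqr_dot HW z)). Qed.

Lemma cos_symbol_le z : cos_symbol W z <= 2^-1 * (m * dot z z).
Proof.
rewrite -RintegralZ_sqr_dot; apply: le_Rintegral => //.
- exact: (integrable_one_sub_cos HW).
- exact: integrableZ_sqr_dot.
- by move=> s _; rewrite mulrCA ler_wpM2l// mulrC one_sub_cos_le.
Qed.

Lemma cos_symbol_ge z :
  (2^-1 - dot z z * delta ^+ 2 / 24) * (m * dot z z) <= cos_symbol W z.
Proof.
rewrite -RintegralZ_sqr_dot; apply: le_Rintegral => //.
- exact: integrableZ_sqr_dot.
- exact: (integrable_one_sub_cos HW).
- move=> s _; have := weight_quartic z s.
  have := ler_wpM2l (W0 (enorm s)) (one_sub_cos_ge (dot z s)); lra.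
Qed.

Lemma sin_symbol_le z : sin_symbol W z z <= m * dot z z.
Proof.
rewrite -[leRHS]mul1r -RintegralZ_sqr_dot; apply: le_Rintegral => //.
- exact: (integrable_dot_sin HW).
- exact: integrableZ_sqr_dot.
- move=> s _; rewrite mul1r ler_wpM2l//.
  by have /andP[] := mul_sin_bounds (dot z s).
Qed.

Lemma sin_symbol_ge z :
  (1 - dot z z * delta ^+ 2 / 6) * (m * dot z z) <= sin_symbol W z z.
Proof.
rewrite -RintegralZ_sqr_dot; apply: le_Rintegral => //.
- exact: integrableZ_sqr_dot.
- exact: (integrable_dot_sin HW).
- move=> s _; have := weight_quartic z s.
  have /andP[H _] := mul_sin_bounds (dot z s).
  have := ler_wpM2l (W0 (enorm s)) H; lra.
Qed.

Lemma cos_symbol_radial z y : dot z z = dot y y -> cos_symbol W z = cos_symbol W y.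
Proof.
exact: (Rintegral_radial mW measurable_one_sub_cos).
Qed.

Lemma cos_symbolB z y : cos_symbol W (vsub z y) <= 2 * cos_symbol W z + 2 * cos_symbol W y.
Proof.
have iC := integrable_one_sub_cos HW.
rewrite /cos_symbol -!RintegralZl//; [|exact: iC|exact: iC].
have iZ w : mu.-integrable setT (EFin \o (fun s => 2 * (W (enorm s) * (1 - cos (dot w s))))).
  exact: (integrableZl measurableT 2 (iC w)).
rewrite -RintegralD//; apply: le_Rintegral => //; first exact: iC.
  exact: (integrableD measurableT (iZ z) (iZ y)).
move=> s _; rewrite dotDl dotZl mulN1r.
have := ler_wpM2l (W0 (enorm s)) (one_sub_cosB (dot z s) (dot y s)); lra.
Qed.

(** The reflection along v fixes z and changes the sign of the integrand. *)
Lemma sin_symbol_perp v z : dot v z = 0 -> sin_symbol W v z = 0.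
Proof.
move=> vz; set F := fun s => W (enorm s) * (dot v s * sin (dot z s)).
have mF : measurable_fun setT F by exact: (measurable_dot_sin HW).
have FN s : F (reflect_along v s) = - F s.
  rewrite /F enorm_reflect !dot_reflect (dotC z v) vz mulr0 subr0.
  suff -> : dot v s - 2 * dot v s / dot v v * dot v v = - dot v s by ring.
  have [v0|v0] := eqVneq (dot v v) 0; last by field.
  suff -> : dot v s = 0 by ring.
  by rewrite /dot big1// => i _; rewrite (dot_eq0 i v0) mul0r.
have : sin_symbol W v z = - sin_symbol W v z.
  rewrite {1}/sin_symbol -/F -(Rintegral_reflect v mF).
  rewrite -mulN1r /sin_symbol -/F -RintegralZl//; last exact: (integrable_dot_sin HW).
  by apply: eq_Rintegral => s _; rewrite FN mulN1r.
lra.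
Qed.

Lemma sin_symbol_linear u a v z :
  sin_symbol W (vadd u (vscale a v)) z = sin_symbol W u z + a * sin_symbol W v z.
Proof.
have iS := integrable_dot_sin HW.
rewrite /sin_symbol -RintegralZl//; last exact: iS.
rewrite -RintegralD//; [|exact: iS|exact: (integrableZl measurableT a (iS v z))].
by apply: eq_Rintegral => s _; rewrite dotDl dotZl; ring.
Qed.

(** Only the component of v along z contributes, by [sin_symbol_perp]: the
  vector-valued symbol of a radial kernel is parallel to z. *)
Lemma sin_symbol_par v z : dot z z != 0 ->
  sin_symbol W v z = dot v z / dot z z * sin_symbol W z z.
Proof.
move=> z0; have := sin_symbol_linear v (- (dot v z / dot z z)) z z.
rewrite sin_symbol_perp; first lra.
by rewrite dotDl dotZl; field.
Qed.

Lemma cos_symbol_increment t z : 0 <= t ->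
  cos_symbol W (vscale (1 + t) z) <=
  cos_symbol W z + t * sin_symbol W z z + t ^+ 2 * (3 / 2 * (m * dot z z)).
Proof.
move=> t0; have iC := integrable_one_sub_cos HW; have iS := integrable_dot_sin HW.
rewrite mulrA -RintegralZ_sqr_dot /cos_symbol /sin_symbol.
rewrite -RintegralZl//; last exact: iS.
have iZ := integrableZl measurableT t (iS z z).
rewrite -RintegralD//; last exact: iC.
have iD := integrableD measurableT (iC z) iZ.
rewrite -RintegralD//; last exact: integrableZ_sqr_dot.
apply: le_Rintegral => //; first exact: iC.
  exact: (integrableD measurableT iD (integrableZ_sqr_dot _ z)).
move=> s _; rewrite dotZl.
have := ler_wpM2l (W0 (enorm s)) (cos_increment t (dot z s)); lra.
Qed.

End bounds.
End symbols.

Section isotropic_pairs.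
Context {R : realType} {n : nat}.
Notation vec := (n.+2.-tuple (measurableTypeR R)).

Definition plane_vec (a b : R) : vec := [tuple of a :: b :: nseq n 0].

Lemma dot_plane_vec a b a' b' :
  dot (plane_vec a b) (plane_vec a' b') = a * a' + b * b'.
Proof.
rewrite /dot !big_ord_recl big1 ?addr0//= => i _.
by rewrite !(tnth_nth 0) /= nth_nseq ltn_ord mul0r.
Qed.

End isotropic_pairs.

(** Take two vectors of length |z| whose difference has length 1/delta. By
  subadditivity ([cos_symbolB]) and radiality, a quarter of the value of the
  symbol at that difference bounds its value at z from below. *)
Lemma cos_symbol_lower (R : realType) n W (delta : R)
    (z : n.-tuple (measurableTypeR R)) : (2 <= n)%N -> 0 < delta ->
  radial_weight (n := n) W delta -> 1 <= dot z z * delta ^+ 2 ->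
  11 / 96 * (weight_mass (n := n) W / n%:R) <= delta ^+ 2 * cos_symbol W z.
Proof.
case: n z => [|[|n]]// z _ d0 HW zd; set m := weight_mass W / _.
have dn0 : delta != 0 by rewrite gt_eqF.
have d2 : 0 < delta ^+ 2 by rewrite exprn_gt0.
(* The vectors (a, b) and (- a, b) have length |z| and differ by (2 a, 0). *)
pose a := (2 * delta)^-1; pose b := Num.sqrt (dot z z - a ^+ 2).
have aE : 4 * a ^+ 2 * delta ^+ 2 = 1 by rewrite /a; field.
have ale : a ^+ 2 <= dot z z.
  rewrite -(ler_pM2r d2); have := sqr_ge0 a; have := mulr_ge0 (sqr_ge0 a) (ltW d2); lra.
have bE : b ^+ 2 = dot z z - a ^+ 2 by rewrite sqr_sqrtr// subr_ge0.
pose z1 := @plane_vec R n a b; pose z2 := @plane_vec R n (- a) b.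
have E1 : dot z1 z1 = dot z z by rewrite dot_plane_vec -!expr2 bE; ring.
have E2 : dot z2 z2 = dot z z by rewrite dot_plane_vec mulrNN -!expr2 bE; ring.
have E12 : dot (vsub z1 z2) (vsub z1 z2) * delta ^+ 2 = 1.
  rewrite /vsub !(dotDl, dotDr, dotZl, dotZr) !dot_plane_vec -[RHS]aE; ring.
have up := cos_symbolB HW z1 z2.
have lo := cos_symbol_ge (ltn0Sn n.+1) (ltW d0) HW (vsub z1 z2).
rewrite (cos_symbol_radial HW E1) (cos_symbol_radial HW E2) in up.
rewrite E12 -/m in lo.
have := ler_wpM2l (ltW d2) (le_trans lo up).
have -> : delta ^+ 2 * ((2^-1 - 1 / 24) * (m * dot (vsub z1 z2) (vsub z1 z2))) =
  11 / 24 * m * (dot (vsub z1 z2) (vsub z1 z2) * delta ^+ 2) by field.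
rewrite E12; lra.
Qed.

(** * Lower bound for the sine symbol of a weight with a power singularity *)

Lemma powR_bernoulli (R : realType) (p t : R) : 0 <= p -> 0 <= t <= 1 ->
  1 + p / 2 * t <= (1 + t) `^ p.
Proof.
move=> p0 /andP[t0 t1]; have t1pos : 0 < 1 + t by lra.
rewrite /powR gt_eqF//; apply: le_trans (expR_ge1Dx _).
rewrite lerD2l -mulrA ler_wpM2l//.
have H : t / (1 + t) <= ln (1 + t).
  have := @le_ln1Dx R (- (t / (1 + t))).
  have -> : 1 + - (t / (1 + t)) = (1 + t)^-1 by field; rewrite gt_eqF.
  rewrite lnV ?posrE// lerN2; apply.
  by rewrite ltrN2 ltr_pdivrMr// mul1r; lra.
apply: le_trans H; rewrite ler_pdivlMr//; nra.
Qed.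

(** Letting t tend to 0. *)
Lemma le_of_le_add_small (R : realType) (x y k : R) : 0 <= k ->
  (forall t, 0 < t <= 1 -> x <= y + t * k) -> x <= y.
Proof.
move=> k0 H; apply/ler_addgt0Pr => e e0.
have t0 : 0 < Num.min 1 (e / (k + 1)).
  by rewrite lt_min ltr01 divr_gt0//; lra.
apply: le_trans (H (Num.min 1 (e / (k + 1))) _) _; first by rewrite t0 ge_min lexx.
rewrite lerD2l; apply: (@le_trans _ _ (e / (k + 1) * k)).
  by rewrite ler_wpM2r// ge_min lexx orbT.
rewrite mulrAC ler_pdivrMr; lra.
Qed.

Section power_weights.
Context {R : realType} {n : nat}.
Notation vec := (n.-tuple (measurableTypeR R)).
Notation mu := (lebesgue_tuple R n).
Variables (W : R -> R) (delta A a beta : R).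
Hypotheses (n2 : (2 <= n)%N) (HW : radial_weight (n := n) W delta).
Hypotheses (beta1 : -1 < beta) (A0 : 0 < A) (a0 : 0 < a).
Hypothesis W_noninc : forall r1 r2, 0 < r1 -> r1 <= r2 ->
  r2 ^+ n * W r2 <= r1 ^+ n * W r1.
Hypothesis W_power : forall r, 0 < r -> r <= a ->
  W r = A * r `^ (- (n%:R + 1 + beta)).
Let W0 := weight_ge0 HW.
Let mW := weight_measurable HW.

(** The restriction of W to the ball on which it is a pure power. *)
Definition core_weight r := if r <= a then W r else 0.

Lemma core_weight_radial : radial_weight (n := n) core_weight a.
Proof.
have mC : measurable_fun setT core_weight.
  by apply: measurable_fun_ifT => //; exact: measurable_fun_ler.
have C0 r : 0 <= core_weight r by rewrite /core_weight; case: ifP.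
split => // [r ar|]; first by rewrite /core_weight leNgt ar.
apply: (weight_dominated HW (k := 1)
  (F := fun s : vec => core_weight (enorm s) * enorm s ^+ 2)).
  have mE := measurable_enorm (@measurable_id _ vec setT).
  apply: measurable_funM; first exact: measurableT_comp mC mE.
  exact: measurable_funX.
have e0 (s : vec) : 0 <= enorm s ^+ 2 by exact: sqr_ge0.
move=> s; rewrite mul1r ger0_norm; last by rewrite mulr_ge0.
by rewrite ler_wpM2r// /core_weight; case: ifP.
Qed.

(** Outside the core this is the monotonicity of r^n W(r) between r / t and r;
  on the core the dilated power is exactly t^(1 + beta) W(r). *)
Lemma dilated_weight_ge t r : 1 <= t -> 0 < r ->
  W r + (t `^ (1 + beta) - 1) * core_weight r <= (t ^+ n)^-1 * W (r / t).
Proof.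
move=> t1 r0; have t0 : 0 < t by lra.
have rt0 : 0 < r / t by rewrite divr_gt0.
have rtr : r / t <= r by rewrite ler_pdivrMr// ler_peMr// ltW.
rewrite /core_weight; case: ifPn => ra; last first.
  rewrite mulr0 addr0 -(ler_pM2l (exprn_gt0 n r0)).
  apply: le_trans (W_noninc rt0 rtr) _.
  by rewrite expr_div_n mulrA.
rewrite W_power// W_power ?(le_trans rtr)//.
have Et : t^-1 `^ (- (n%:R + 1 + beta)) = t ^+ n * t `^ (1 + beta).
  rewrite -powR_inv1 ?(ltW t0)// -powRrM -(powR_mulrn n (ltW t0)) -powRD.
    by congr (_ `^ _); ring.
  by rewrite (gt_eqF t0) implybT.
rewrite powRM ?invr_ge0 ?(ltW t0) ?(ltW r0)// Et.
rewrite le_eqVlt; apply/orP; left; apply/eqP; field.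
by rewrite expf_neq0// gt_eqF.
Qed.

Lemma cos_symbol_dilate t (z : vec) : 1 <= t ->
  cos_symbol W z + (t `^ (1 + beta) - 1) * cos_symbol core_weight z <=
  cos_symbol W (vscale t z).
Proof.
move=> t1; have t0 : 0 < t by lra.
set k := _ - 1.
have k0 : 0 <= k.
  have b0 : 0 <= 1 + beta by rewrite -lerBlDl sub0r ltW.
  rewrite subr_ge0; have := ge0_ler_powR b0 (_ : 1 \in Num.nneg) (_ : t \in Num.nneg) t1.
  by rewrite powR1 !nnegrE; apply => //; exact: ltW.
have iC := integrable_one_sub_cos HW.
have iK := integrable_one_sub_cos core_weight_radial.
have iZ := integrableZl measurableT k (iK z).
rewrite /cos_symbol -[k * _]RintegralZl//; last exact: iK.
rewrite -RintegralD//; last exact: iC.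
have iD := integrableD measurableT (iC z) iZ.
rewrite /Rintegral fine_le//.
- exact: (integrable_fin_num measurableT iD).
- exact: (integrable_fin_num measurableT (iC _)).
(* The factor t^n cancels the Jacobian of the dilation s := t s. *)
pose g (s : vec) := ((t ^+ n * ((t ^+ n)^-1 * W (enorm s / t) * (1 - cos (dot z s)))))%:E.
have tn0 : 0 < t ^+ n by rewrite exprn_gt0.
have mE := measurable_enorm (@measurable_id _ vec setT).
have mz : measurable_fun setT (fun s : vec => 1 - cos (dot z s)).
  apply: (measurableT_comp measurable_one_sub_cos).
  exact: measurable_dot (@measurable_cst _ _ _ _ _ _) (@measurable_id _ vec setT).
have mh : measurable_fun setT (fun s : vec => (t ^+ n)^-1 * W (enorm s / t) * (1 - cos (dot z s))).
  apply: measurable_funM => //; apply: measurable_funM => //.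
  by apply: (measurableT_comp mW); apply: measurable_funM.
have mg : measurable_fun setT g by apply/measurable_EFinP; apply: measurable_funM.
have c0 x : 0 <= 1 - cos x :> R by rewrite subr_ge0 cos_le1.
have h0 (s : vec) : 0 <= (t ^+ n)^-1 * W (enorm s / t) * (1 - cos (dot z s)).
  by rewrite !mulr_ge0// invr_ge0 ltW.
have g0 s : (0 <= g s)%E by rewrite lee_fin mulr_ge0// ltW.
rewrite [leRHS](_ : _ = \int[mu]_s g (vscale t s))%E; last first.
  apply: eq_integral => s _; rewrite /g enorm_vscale gtr0_norm// dotZl dotZr.
  rewrite [t * enorm s]mulrC mulfK ?gt_eqF//; congr (_%:E).
  by field; rewrite expf_neq0// gt_eqF.
rewrite lebesgue_dilate// -ge0_integralZl//; last by rewrite lee_fin invr_ge0 ltW.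
apply: ge0_le_integral => //.
- move=> s _; rewrite lee_fin.
  by rewrite addr_ge0 ?mulr_ge0// ?(weight_ge0 core_weight_radial).
- exact: measurable_int iD.
- by apply: emeasurable_funM.
move=> s _; rewrite /g -EFinM lee_fin [leRHS]mulrA mulVf ?gt_eqF// mul1r.
have [s0|s0] := ltrP 0 (enorm s).
  by rewrite (mulrA k) -mulrDl ler_wpM2r// dilated_weight_ge.
have sE : enorm s = 0 by apply/eqP; rewrite eq_le s0 enorm_ge0.
have -> : dot z s = 0.
  apply/eqP; rewrite -normr_le0; apply: le_trans (ler_norm_dot _ _) _.
  by rewrite sE mulr0.
by rewrite cos0 subrr !mulr0 addr0.
Qed.

(** Since n >= 2, the integrand W(r) r^2 = A r^(1 - n - beta) is a negative
  power on the core, so it is bounded below by its value at r = a. *)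
Lemma core_mass_ge :
  A * a `^ (1 - beta) / n.+1%:R ^+ n <= weight_mass (n := n) core_weight.
Proof.
have n0 : (0 < n)%N by exact: ltnW.
have HC := core_weight_radial.
rewrite -lee_fin /weight_mass /Rintegral fineK; last first.
  exact: (integrable_fin_num measurableT (weight_integrable HC)).
(* The power law says nothing at r = 0; the origin is null. *)
pose D := eball (n := n) a `\` [set s | enorm s = 0].
have mS := @measurable_esphere R n 0.
have mB := @measurable_eball R n a.
have mD : measurable D by exact: measurableD.
have S0 : mu [set s | enorm s = 0] = 0%E.
  by case: (n) n0 => // m _; exact: esphere_null.
have muD : mu D = mu (eball a).
  apply/eqP; rewrite eq_le; apply/andP; split.
    by apply: le_measure; rewrite ?inE//; exact: subDsetl.
  rewrite -[leRHS]adde0 -S0; apply: le_trans (measureU2 _ _ _) => //.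
  apply: le_measure; rewrite ?inE//; first exact: measurableU.
  move=> s sB; have [s0|s0] := eqVneq (enorm s) 0; [by right|left].
  by split => //; exact/eqP.
pose c := A * a `^ (1 - n%:R - beta).
have c0 : 0 <= c by rewrite mulr_ge0 ?powR_ge0// ltW.
apply: (@le_trans _ _ (c%:E * mu D)%E).
  rewrite muD; apply: le_trans (lee_wpmul2l _ (eball_volume_lb (ltW a0))); last first.
    by rewrite lee_fin.
  rewrite -EFinM lee_fin expr_div_n mulrA ler_wpM2r ?invr_ge0 ?exprn_ge0//.
  rewrite -mulrA ler_wpM2l ?(ltW A0)// -(powR_mulrn n (ltW a0)) -powRD; last first.
    by rewrite (gt_eqF a0) implybT.
  by rewrite (_ : 1 - n%:R - beta + n%:R = 1 - beta)//; ring.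
rewrite -[X in mu X]setIT -integral_indic// -ge0_integralZl//; last first.
  exact/measurable_EFinP/measurable_indic.
apply: ge0_le_integral => //.
- by move=> s _; rewrite mule_ge0.
- by apply: emeasurable_funM => //; exact/measurable_EFinP/measurable_indic.
- exact: measurable_int (weight_integrable HC).
move=> s _; rewrite -EFinM lee_fin indicE.
have [|_] := boolP (s \in D); last first.
  by rewrite mulr0 mulr_ge0 ?sqr_ge0// (weight_ge0 HC).
rewrite inE => -[sa s0]; rewrite mulr1 /core_weight; move: (sa) => /= ->.
have {}s0 : 0 < enorm s by rewrite lt_neqAle enorm_ge0 andbT eq_sym; exact/eqP.
rewrite W_power// /c -mulrA ler_wpM2l ?(ltW A0)//.
rewrite -(powR_mulrn 2 (ltW s0)) -powRD; last by rewrite (gt_eqF s0) implybT.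
rewrite (_ : _ + 2%:R = - (n%:R - 1 + beta)); last by ring.
rewrite (_ : 1 - n%:R - beta = - (n%:R - 1 + beta)); last by ring.
rewrite !powRN lef_pV2 ?posrE ?powR_gt0//.
have n1 : 2 <= n%:R :> R by rewrite ler_nat.
have b1 := beta1.
rewrite ge0_ler_powR ?nnegrE//; [lra|exact: ltW|exact: ltW].
Qed.

(** Compare the upper bound of [cos_symbol_increment] and the lower bound of
  [cos_symbol_dilate] for the symbol at (1 + t) z, divide by t and let t tend to
  0. The core part of the symbol at z is then bounded below by Taylor's formula,
  because a |z| <= 1. *)
Lemma sin_symbol_lower (z : vec) : dot z z * a ^+ 2 <= 1 ->
  (1 + beta) / 8 * (A * a `^ (1 - beta) / n.+1%:R ^+ n / n%:R) * dot z z
    <= sin_symbol W z z.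
Proof.
move=> za; have n0 : (0 < n)%N by exact: ltnW.
have HC := core_weight_radial.
set m := weight_mass (n := n) W / n%:R.
have nn : 0 < n%:R :> R by rewrite ltr0n.
have mass0 V : (forall r, 0 <= V r) -> 0 <= weight_mass (n := n) V.
  by move=> V0; apply: Rintegral_ge0 => s _; rewrite mulr_ge0// sqr_ge0.
have H : (1 + beta) / 2 * cos_symbol core_weight z <= sin_symbol W z z.
  apply: (@le_of_le_add_small _ _ _ (3 / 2 * (m * dot z z))).
    by rewrite !mulr_ge0 ?dot_ge0 ?mass0// invr_ge0 ltW.
  move=> t /andP[t0 t1].
  have c0 : 0 <= cos_symbol core_weight z.
    by apply: Rintegral_ge0 => s _; rewrite mulr_ge0 ?(weight_ge0 HC)// subr_ge0 cos_le1.
  have b0 : 0 <= 1 + beta by rewrite -lerBlDl sub0r ltW.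
  have tt : 0 <= t <= 1 by rewrite (ltW t0).
  have t11 : 1 <= 1 + t by lra.
  have S := cos_symbol_increment n0 HW z (ltW t0); rewrite -/m in S.
  have Q := cos_symbol_dilate z t11.
  have P := ler_wpM2r c0 (powR_bernoulli b0 tt).
  rewrite -(ler_pM2l t0).
  move: P Q S; set X := _ `^ _; lra.
apply: le_trans H; have := cos_symbol_ge n0 (ltW a0) HC z.
have M := core_mass_ge; move=> L.
have b0 : 0 <= (1 + beta) / 2.
  by rewrite divr_ge0// -lerBlDl sub0r ltW.
rewrite (_ : _ * dot z z = (1 + beta) / 2 *
  (4^-1 * (A * a `^ (1 - beta) / n.+1%:R ^+ n / n%:R * dot z z))); last by set Q := A * _ / _ / _; field.
rewrite ler_wpM2l//; apply: le_trans L; apply: ler_pM => //.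
- by rewrite mulr_ge0 ?dot_ge0// !mulr_ge0 ?powR_ge0 ?invr_ge0// ltW.
- lra.
- by rewrite ler_wpM2r ?dot_ge0// ler_wpM2r// invr_ge0 ltW.
Qed.

End power_weights.

(** * The symbols of the nonlocal operators *)

Section cut_kernels.
Context {R : realType} {n : nat}.
Notation vec := (n.-tuple (measurableTypeR R)).
Notation mu := (lebesgue_tuple R n).
Variables (K : R -> R) (delta : R).
Hypotheses (n0 : (0 < n)%N) (delta0 : 0 < delta).
Hypothesis mK : measurable_fun (`]0, +oo[%classic : set R) K.
Hypothesis K0 : forall r, 0 < r -> 0 <= K r.
Hypothesis K_support : forall r, delta < r -> K r = 0.

(** Vanishing at delta, and not only beyond, makes r^n W(r) monotone on the
  whole half-line although nothing is known about the kernel at its endpoint. *)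
Definition cut_kernel r := if r < delta then if 0 < r then K r else 0 else 0.

Lemma measurable_pos_kernel : measurable_fun setT (fun r : R => if 0 < r then K r else 0).
Proof.
rewrite (_ : (fun _ => _) = K \_ `]0, +oo[%classic); first by apply/(measurable_restrictT _ _).1.
by apply/funext => r; rewrite patchE mem_setE in_itv /= andbT.
Qed.

Lemma measurable_cut_kernel : measurable_fun setT cut_kernel.
Proof.
apply: measurable_fun_ifT => //; last exact: measurable_pos_kernel.
exact: measurable_fun_ltr.
Qed.

Lemma cut_kernel_ge0 r : 0 <= cut_kernel r.
Proof. by rewrite /cut_kernel; do 2 case: ifP => //; move=> ? _; exact: K0. Qed.

(** The two integrands differ at most on the sphere |s| = delta, which is
  null, and at the origin phi vanishes. *)
Lemma integral_cut_kernel (phi : vec -> R) : measurable_fun setT phi ->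
  (forall s, enorm s = 0 -> phi s = 0) ->
  (\int[mu]_s (K (enorm s) * phi s)%:E = \int[mu]_s (cut_kernel (enorm s) * phi s)%:E)%E.
Proof.
move=> mphi phi0; have mE := measurable_enorm (@measurable_id _ vec setT).
transitivity (\int[mu]_s ((if 0 < enorm s then K (enorm s) else 0) * phi s)%:E)%E.
  apply: eq_integral => s _; case: ifPn => //; rewrite -leNgt => s0.
  by rewrite phi0 ?mulr0//; apply/eqP; rewrite eq_le s0 enorm_ge0.
apply: ae_eq_integral => //.
- apply/measurable_EFinP; apply: measurable_funM => //.
  exact: measurableT_comp measurable_pos_kernel mE.
- apply/measurable_EFinP; apply: measurable_funM => //.
  exact: measurableT_comp measurable_cut_kernel mE.
exists [set s | enorm s = delta]; split.
- exact: measurable_esphere.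
- by case: (n) n0 => // m _; exact: esphere_null.
move=> s /= H; apply: contrapT => sd; apply: H => _; rewrite /cut_kernel.
case: (ltrP (enorm s) delta) => // ds.
have {}ds : delta < enorm s by rewrite lt_neqAle ds andbT eq_sym; exact/eqP.
by rewrite (lt_trans delta0 ds) K_support// mul0r.
Qed.

Lemma Rintegral_cut_kernel (phi : vec -> R) : measurable_fun setT phi ->
  (forall s, enorm s = 0 -> phi s = 0) ->
  \int[mu]_(s in [set s | enorm s <= delta]) (K (enorm s) * phi s) =
  \int[mu]_s (cut_kernel (enorm s) * phi s).
Proof.
move=> mphi phi0; rewrite Rintegral_mkcond /Rintegral -integral_cut_kernel//.
congr fine; apply: eq_integral => s _; rewrite patchE; case: ifPn => // sd.
rewrite K_support ?mul0r//; rewrite ltNge; apply: contra sd => sd.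
by rewrite inE.
Qed.

Lemma cut_kernel_radial_weight m :
  (\int[mu]_s (K (enorm s) * enorm s ^+ 2)%:E = m%:E)%E ->
  radial_weight (n := n) cut_kernel delta /\ weight_mass (n := n) cut_kernel = m.
Proof.
have mE := measurable_enorm (@measurable_id _ vec setT).
have mE2 : measurable_fun setT (fun s : vec => enorm s ^+ 2) by exact: measurable_funX.
rewrite integral_cut_kernel//; last by move=> s ->; rewrite expr0n.
move=> Km; split; last by rewrite /weight_mass /Rintegral Km.
split.
- exact: measurable_cut_kernel.
- exact: cut_kernel_ge0.
- by move=> r dr; rewrite /cut_kernel ltNge (ltW dr).
apply/integrableP; split.
  apply/measurable_EFinP; apply: measurable_funM => //.
  exact: measurableT_comp measurable_cut_kernel mE.
rewrite (eq_integral (fun s => (cut_kernel (enorm s) * enorm s ^+ 2)%:E)); last first.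
  move=> s _; rewrite gee0_abs// lee_fin mulr_ge0 ?cut_kernel_ge0//.
  exact: sqr_ge0.
by rewrite Km ltry.
Qed.

End cut_kernels.

Lemma measurable_dilated_kernel (R : realType) (omega : R -> R) (delta : R) :
  0 < delta -> is_kernel omega ->
  measurable_fun (`]0, +oo[%classic : set R) (fun r => omega (r / delta)).
Proof.
move=> d0 [mw _ _].
apply: (measurable_comp _ _ mw) => //.
- move=> _ [r /= + <-]; rewrite !in_itv /= !andbT => r0.
  by rewrite divr_gt0.
- by apply: measurable_funTS; apply: mulrr_measurable.
Qed.

Section stokes_symbols.
Context {R : realType} {d : nat}.
Variables (omega omegah : R -> R) (beta : R).
Hypotheses (d2 : (2 <= d)%N) (Hker : kernel_assumptions d omega omegah beta).
Let d0 : (0 < d)%N := ltnW d2.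

Section fixed_delta.
Variable delta : R.
Hypothesis delta0 : 0 < delta.

Definition laplacian_weight := cut_kernel (scaled_omega d omega delta) delta.
Definition gradient_weight :=
  cut_kernel (fun r => scaled_omega_hat d omegah delta r / r) delta.

Let mom2 := kernel_moment2 Hker delta0.
Let mom1 := kernel_moment1 Hker delta0.

Lemma measurable_scaled_omega :
  measurable_fun (`]0, +oo[%classic : set R) (scaled_omega d omega delta).
Proof.
by apply: measurable_funM => //; exact: (measurable_dilated_kernel delta0 (kernel_omega Hker)).
Qed.

Lemma scaled_omega_ge0 r : 0 < r -> 0 <= scaled_omega d omega delta r.
Proof.
move=> r0; have [_ w0 _] := kernel_omega Hker.
by rewrite mulr_ge0 ?invr_ge0 ?exprn_ge0 ?w0 ?divr_gt0// ltW.
Qed.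

Lemma scaled_omega_support r : delta < r -> scaled_omega d omega delta r = 0.
Proof.
move=> r0; have [_ _ w1] := kernel_omega Hker.
by rewrite /scaled_omega w1 ?mulr0// ltr_pdivlMr// mul1r.
Qed.

Lemma measurable_scaled_omega_hat : measurable_fun (`]0, +oo[%classic : set R)
  (fun r => scaled_omega_hat d omegah delta r / r).
Proof.
apply: measurable_funM.
  by apply: measurable_funM => //; exact: (measurable_dilated_kernel delta0 (kernel_omega_hat Hker)).
apply: (eq_measurable_fun (fun r => r `^ (-1))).
  by move=> r; rewrite inE /= in_itv /= andbT => r0; rewrite powR_inv1// ltW.
by apply: measurable_funTS; exact: measurable_powR.
Qed.

Lemma scaled_omega_hat_ge0 r : 0 < r -> 0 <= scaled_omega_hat d omegah delta r / r.
Proof.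
move=> r0; have [_ w0 _] := kernel_omega_hat Hker.
by rewrite divr_ge0 ?mulr_ge0 ?invr_ge0 ?exprn_ge0 ?w0 ?divr_gt0// ltW.
Qed.

Lemma scaled_omega_hat_support r : delta < r ->
  scaled_omega_hat d omegah delta r / r = 0.
Proof.
move=> r0; have [_ _ w1] := kernel_omega_hat Hker.
by rewrite /scaled_omega_hat w1 ?mulr0 ?mul0r// ltr_pdivlMr// mul1r.
Qed.

Lemma laplacian_weight_radial : radial_weight (n := d) laplacian_weight delta /\
  weight_mass (n := d) laplacian_weight = 2 * d%:R.
Proof.
apply: cut_kernel_radial_weight => //.
- exact: measurable_scaled_omega.
- exact: scaled_omega_ge0.
- exact: scaled_omega_support.
have := congr1 (fun x => 2%:E * x)%E mom2.
by rewrite muleA -!EFinM divff// mul1e.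
Qed.

Lemma gradient_weight_radial : radial_weight (n := d) gradient_weight delta /\
  weight_mass (n := d) gradient_weight = d%:R.
Proof.
apply: cut_kernel_radial_weight => //.
- exact: measurable_scaled_omega_hat.
- exact: scaled_omega_hat_ge0.
- exact: scaled_omega_hat_support.
rewrite -mom1; apply: eq_integral => s _; congr (_%:E).
have [->|s0] := eqVneq (enorm s) 0; first by rewrite expr0n !mulr0.
by field.
Qed.

Lemma lambda_symbolE (xi : freq d) :
  lambda_symbol omega delta xi = cos_symbol laplacian_weight (wave xi).
Proof.
apply: Rintegral_cut_kernel => //.
- exact: measurable_scaled_omega.
- exact: scaled_omega_support.
- apply: (measurableT_comp measurable_one_sub_cos).
  exact: measurable_dot (@measurable_cst _ _ _ _ _ _) (@measurable_id _ _ setT).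
move=> s s0; rewrite (_ : dot (wave xi) s = 0) ?cos0 ?subrr//.
apply/eqP; rewrite -normr_le0; apply: le_trans (ler_norm_dot _ _) _.
by rewrite s0 mulr0.
Qed.

Lemma b_symbolE (xi : freq d) j :
  b_symbol omegah delta xi j 0 = sin_symbol gradient_weight (unit_vec j) (wave xi).
Proof.
have mid := @measurable_id _ (d.-tuple (measurableTypeR R)) setT.
have mdot v : measurable_fun setT (fun s : d.-tuple (measurableTypeR R) => dot v s).
  exact: measurable_dot (@measurable_cst _ _ _ _ _ _) mid.
rewrite mxE /sin_symbol -Rintegral_cut_kernel//.
- by apply: eq_Rintegral => s _; rewrite dot_unit_vec; ring.
- exact: measurable_scaled_omega_hat.
- exact: scaled_omega_hat_support.
- apply: measurable_funM; first exact: mdot.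
  exact: measurableT_comp measurable_sin (mdot _).
move=> s s0; rewrite (_ : dot (wave xi) s = 0) ?sin0 ?mulr0//.
apply/eqP; rewrite -normr_le0; apply: le_trans (ler_norm_dot _ _) _.
by rewrite s0 mulr0.
Qed.

(** Up to the factor delta^(-2), r^d W(r) is the monotone function of the
  kernel assumptions evaluated at r / delta. *)
Lemma gradient_weight_noninc r1 r2 : 0 < r1 -> r1 <= r2 ->
  r2 ^+ d * gradient_weight r2 <= r1 ^+ d * gradient_weight r1.
Proof.
move=> r10 r12; have r20 := lt_le_trans r10 r12.
rewrite /gradient_weight /cut_kernel r10 r20.
have [r2d|r2d] := ltrP r2 delta; last first.
  rewrite mulr0 mulr_ge0 ?exprn_ge0 ?(ltW r10)//; case: ifP => // _.
  exact: scaled_omega_hat_ge0.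
rewrite (le_lt_trans r12 r2d).
have E r : 0 < r -> r ^+ d * (scaled_omega_hat d omegah delta r / r) =
   (delta ^+ 2)^-1 * ((r / delta) ^+ d.-1 * omegah (r / delta)).
  move=> r0; rewrite /scaled_omega_hat expr_div_n.
  have -> : d = d.-1.+1 by rewrite prednK.
  rewrite /= addn1 !exprS; field.
  by rewrite expf_neq0 !gt_eqF.
rewrite !E// ler_wpM2l ?invr_ge0 ?exprn_ge0 ?(ltW delta0)//.
apply: (kernel_nonincreasing Hker); first by rewrite divr_gt0.
  by rewrite ler_pM2r// invr_gt0.
by rewrite ltr_pdivrMr// mul1r.
Qed.

Lemma gradient_weight_power eps c r :
  (forall r, 0 < r < eps -> omegah r = c * r `^ (- d%:R - beta)) -> eps <= 1 ->
  0 < r -> r < eps * delta ->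
  gradient_weight r = c * delta `^ (beta - 1) * r `^ (- (d%:R + 1 + beta)).
Proof.
move=> Hpow eps1 r0 red.
have rd : r < delta by apply: lt_le_trans red _; rewrite ler_piMl// ltW.
rewrite /gradient_weight /cut_kernel rd r0 /scaled_omega_hat Hpow; last first.
  by rewrite divr_gt0//= ltr_pdivrMr.
have dl := ltW delta0; have rl := ltW r0.
rewrite powRM ?invr_ge0// -(powR_inv1 dl) -powRrM -(powR_inv1 rl).
rewrite -(powR_mulrn (d + 1) dl) -powRN.
rewrite (_ : _ * (c * _) * _ = c *
   (delta `^ (- (d + 1)%:R) * delta `^ (-1 * (- d%:R - beta))) *
   (r `^ (- d%:R - beta) * r `^ (-1))); last by ring.
rewrite -!powRD ?(gt_eqF delta0) ?(gt_eqF r0) ?implybT//.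
by rewrite natrD; congr (_ * _ `^ _ * _ `^ _); ring.
Qed.

End fixed_delta.
End stokes_symbols.

Arguments laplacian_weight {R} d omega delta r.
Arguments gradient_weight {R} d omegah delta r.

(** * Relative errors of the symbols *)

Section wave_vectors.
Context {R : realType} {d : nat}.
Implicit Types xi : freq d.

Lemma tnth_wave xi j : tnth (wave xi) j = (xi 0 j)%:~R :> R.
Proof. by rewrite tnth_mktuple. Qed.

Lemma sqr_wavenumber xi : wavenumber xi ^+ 2 = dot (wave xi) (wave xi) :> R.
Proof. exact: sqr_enorm. Qed.

Lemma wavenumber_ge1 xi : xi != 0 -> 1 <= wavenumber xi :> R.
Proof.
move=> xi0; have [j xij] : exists j, xi 0 j != 0.
  apply/existsP; apply: contraR xi0; rewrite negb_exists => /forallP H.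
  apply/eqP/rowP => j; rewrite mxE; apply/eqP; have := H j; by rewrite negbK.
rewrite -(@ler_pXn2r _ 2)// ?nnegrE ?enorm_ge0// expr1n sqr_wavenumber.
apply: le_trans (coord_sqr_le j _); rewrite tnth_wave -rmorphXn /= ler1z.
by rewrite -gtz0_ge1 exprn_even_gt0//= xij orbT.
Qed.

End wave_vectors.

(** The quantity delta^min(2,1+eta) w^(1+eta) dominates rho^2 or equals
  rho^(1+eta), where rho = delta w, according to the position of eta with
  respect to 1. *)
Lemma sobolev_scaling (R : realType) (delta w eta : R) : 0 < delta -> 1 <= w ->
  let B := delta `^ Num.min 2 (1 + eta) * w `^ (1 + eta) in
  (eta <= 1 -> B = (delta * w) `^ (1 + eta)) /\
  (1 <= eta -> (delta * w) ^+ 2 <= B).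
Proof.
move=> d0 w1; have w0 : 0 < w by lra.
split=> eta1.
  have min2 : 1 + eta <= 2 by lra.
  by rewrite (min_r min2) powRM// ltW.
rewrite min_l; last lra.
rewrite exprMn -(powR_mulrn 2 (ltW d0)) -(powR_mulrn 2 (ltW w0)).
rewrite ler_wpM2l ?powR_ge0// ler_powR//; lra.
Qed.

Section symbol_errors.
Context {R : realType} {d : nat}.
Variables (omega omegah : R -> R) (beta : R).
Hypotheses (d2 : (2 <= d)%N) (Hker : kernel_assumptions d omega omegah beta).
Let d0 : (0 < d)%N := ltnW d2.

(** If x delta^2 <= 1 then lambda = x (1 + O(x delta^2)); otherwise lambda is
  at least a multiple of delta^(-2), and 0 <= x / lambda - 1 <= x / lambda. *)
Lemma lambda_error (delta : R) (xi : freq d) : 0 < delta -> xi != 0 ->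
  let L := lambda_symbol omega delta xi in
  let x := wavenumber xi ^+ 2 in
  0 < L /\ `|x / L - 1| <= 5 * delta ^+ 2 * x.
Proof.
move=> delta0 xi0 L x.
have [HW HM] := laplacian_weight_radial d2 Hker delta0.
have dn : d%:R != 0 :> R by rewrite pnatr_eq0 -lt0n.
have x1 : 1 <= x by rewrite -(expr1n _ 2) ler_pXn2r ?nnegrE ?enorm_ge0// wavenumber_ge1.
have LE : L = cos_symbol (laplacian_weight d omega delta) (wave xi).
  exact: (lambda_symbolE d2 Hker delta0 xi).
have := cos_symbol_le d0 HW (wave xi).
have := cos_symbol_ge d0 (ltW delta0) HW (wave xi).
have := cos_symbol_lower d2 delta0 HW (z := wave xi).
rewrite -LE HM mulfK// -sqr_wavenumber -/x => L3 L2 L1.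
have d2pos : 0 < delta ^+ 2 by rewrite exprn_gt0.
set y := x * delta ^+ 2 in L2 L3.
have y0 : 0 <= y by rewrite mulr_ge0 ?ltW//; lra.
have L1' : L <= x by lra.
have [y1|y1] := lerP y 1.
  have Llow : 11 / 12 * x <= L by nra.
  have L0 : 0 < L by lra.
  split => //; have -> : x / L - 1 = (x - L) / L by field; rewrite gt_eqF.
  rewrite ger0_norm ?divr_ge0 ?subr_ge0 ?(ltW L0)//.
  rewrite ler_pdivrMr// -mulrA (mulrC _ x) -/y.
  have : 5 * y * (11 / 12 * x) <= 5 * y * L by rewrite ler_wpM2l//; lra.
  nra.
have {}L3 := L3 (ltW y1).
have L0 : 0 < L by rewrite -(pmulr_rgt0 _ d2pos); lra.
split => //; rewrite ger0_norm; last by rewrite subr_ge0 ler_pdivlMr// mul1r.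
apply: (@le_trans _ _ (x / L)); first by rewrite gerBl.
rewrite ler_pdivrMr// -mulrA (mulrC _ x) (_ : 5 * _ * L = 5 * x * (delta ^+ 2 * L)); last by ring.
nra.
Qed.

Definition gradient_factor (delta : R) (xi : freq d) : R :=
  sin_symbol (gradient_weight d omegah delta) (wave xi) (wave xi) / wavenumber xi ^+ 2.

Lemma sqr_wavenumber_ge1 (xi : freq d) : xi != 0 -> 1 <= wavenumber xi ^+ 2 :> R.
Proof. by move=> xi0; rewrite -(expr1n _ 2) ler_pXn2r ?nnegrE ?enorm_ge0// wavenumber_ge1. Qed.

Lemma b_symbol_parallel (delta : R) (xi : freq d) j : 0 < delta -> xi != 0 ->
  b_symbol omegah delta xi j 0 = gradient_factor delta xi * (xi 0 j)%:~R.
Proof.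
move=> delta0 xi0; have [HW _] := gradient_weight_radial d2 Hker delta0.
have x1 := sqr_wavenumber_ge1 xi0.
rewrite (b_symbolE d2 Hker delta0) (sin_symbol_par HW); last first.
  by rewrite -sqr_wavenumber gt_eqF//; lra.
by rewrite dot_unit_vec tnth_wave -sqr_wavenumber /gradient_factor; ring.
Qed.

Lemma gradient_factor_bounds (delta : R) (xi : freq d) : 0 < delta -> xi != 0 ->
  1 - (delta * wavenumber xi) ^+ 2 / 6 <= gradient_factor delta xi <= 1.
Proof.
move=> delta0 xi0; have [HW HM] := gradient_weight_radial d2 Hker delta0.
have dn : d%:R != 0 :> R by rewrite pnatr_eq0 -lt0n.
have x1 := sqr_wavenumber_ge1 xi0.
have x0 : 0 < wavenumber xi ^+ 2 :> R by lra.
have := sin_symbol_le d0 HW (wave xi).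
have := sin_symbol_ge d0 (ltW delta0) HW (wave xi).
rewrite HM divff// mul1r -sqr_wavenumber => L2 L1.
rewrite /gradient_factor ler_pdivlMr// ler_pdivrMr// mul1r L1 andbT.
by apply: le_trans L2; rewrite exprMn [_ * delta ^+ 2]mulrC.
Qed.

(** The weight is a pure power of amplitude c delta^(beta - 1) for
  r < eps delta; the core radius eps / (2 w) lies in that range since
  delta w >= 1. *)
Lemma gradient_factor_lower : exists2 c0, 0 < c0 & forall (delta : R) (xi : freq d),
  0 < delta -> xi != 0 -> 1 <= delta * wavenumber xi ->
  c0 * (delta * wavenumber xi) `^ (beta - 1) <= gradient_factor delta xi.
Proof.
have [eps [c [/andP[eps0 eps1] c0 Hpow]]] := kernel_power Hker.
have /andP[b1 b2] := kernel_exponent Hker.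
have dn : 0 < d%:R :> R by rewrite ltr0n.
have dn1 : 0 < d.+1%:R ^+ d :> R by rewrite exprn_gt0// ltr0n.
have e2 : 0 < eps / 2 by rewrite divr_gt0.
exists ((1 + beta) / 8 * (c * (eps / 2) `^ (1 - beta) / d.+1%:R ^+ d / d%:R)).
  have b0 : 0 < 1 + beta by rewrite -ltrBlDl sub0r.
  by rewrite mulr_gt0 ?divr_gt0 ?mulr_gt0 ?powR_gt0.
move=> delta xi delta0 xi0 rho1.
have [HW _] := gradient_weight_radial d2 Hker delta0.
have w1 : 1 <= wavenumber xi :> R := wavenumber_ge1 xi0.
set w : R := wavenumber xi in w1 rho1 *; have w0 : 0 < w by lra.
pose a := eps / 2 / w.
have a0 : 0 < a by rewrite divr_gt0.
have aw : a * w = eps / 2 by rewrite /a mulfVK// gt_eqF.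
have A0 : 0 < c * delta `^ (beta - 1) by rewrite mulr_gt0// powR_gt0.
have pow r : 0 < r -> r <= a -> gradient_weight d omegah delta r =
    c * delta `^ (beta - 1) * r `^ (- (d%:R + 1 + beta)).
  move=> r0 ra; apply: (gradient_weight_power delta0 Hpow) => //.
  apply: le_lt_trans ra _; rewrite -(ltr_pM2r w0) aw.
  have := ler_wpM2l (ltW eps0) rho1; rewrite mulr1 mulrA; lra.
have za : dot (wave xi) (wave xi) * a ^+ 2 <= 1.
  rewrite -sqr_wavenumber -/w -exprMn mulrC aw expr_le1//; lra.
have x0 : 0 < w ^+ 2 by rewrite exprn_gt0.
have := sin_symbol_lower d2 HW b1 A0 a0 (gradient_weight_noninc d2 Hker delta0) pow za.
rewrite /gradient_factor -/w ler_pdivlMr// -sqr_wavenumber -/w.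
apply: le_trans; rewrite ler_wpM2r ?(ltW x0)// le_eqVlt; apply/orP; left; apply/eqP.
rewrite (powRM _ (ltW delta0) (ltW w0)) /a (powRM _ (ltW e2)) ?invr_ge0 ?(ltW w0)//.
rewrite -(powR_inv1 (ltW w0)) -powRrM (_ : -1 * (1 - beta) = beta - 1); last by ring.
by field; rewrite !gt_eqF.
Qed.

(** If rho = delta w <= 1, the Taylor bound gives an error at most rho^2;
  otherwise the error is at most a multiple of rho^(1 - beta), and
  1 - beta <= 1 + eta. *)
Lemma gradient_factor_error : exists C0 : R, forall (delta : R) (xi : freq d),
  0 < delta -> xi != 0 -> 0 < gradient_factor delta xi /\
  forall eta, - beta <= eta -> `|(gradient_factor delta xi)^-1 - 1| <=
    C0 * (delta `^ Num.min 2 (1 + eta) * wavenumber xi `^ (1 + eta)).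
Proof.
have [c0 c0pos low] := gradient_factor_lower.
have /andP[b1 b2] := kernel_exponent Hker.
exists (c0^-1 + 1) => delta xi delta0 xi0.
have /andP[k2 k1] := gradient_factor_bounds delta0 xi0.
have {}low := low delta xi delta0 xi0.
have w1 : 1 <= wavenumber xi :> R := wavenumber_ge1 xi0.
set w : R := wavenumber xi in w1 low k2 *.
set k := gradient_factor delta xi in k1 k2 low *.
have w0 : 0 < w by lra.
have rho0 : 0 < delta * w by rewrite mulr_gt0.
set rho := delta * w in rho0 low k2 *.
have c00 : 0 < c0^-1 by rewrite invr_gt0.
have kpos : 0 < k.
  have [r1|r1] := lerP rho 1.
    have : rho ^+ 2 <= 1 by rewrite expr_le1// ltW.
    lra.
  by apply: lt_le_trans (low (ltW r1)); rewrite mulr_gt0// powR_gt0.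
split => // eta eta_b.
have [B1 B2] := @sobolev_scaling R delta w eta delta0 w1.
rewrite -/rho in B1 B2; set B := _ `^ _ * _ in B1 B2 *.
have Bpos : 0 <= B by rewrite mulr_ge0 ?powR_ge0.
have kV : 1 <= k^-1 by rewrite invf_ge1.
rewrite ger0_norm ?subr_ge0//.
have [r1|r1] := lerP rho 1.
  have rB : rho ^+ 2 <= B.
    have [e1|e1] := lerP 1 eta; first exact: B2.
    rewrite (B1 (ltW e1)) -(powR_mulrn 2 (ltW rho0)).
    rewrite ger_powR ?rho0//; lra.
  have r2 : rho ^+ 2 <= 1 by rewrite expr_le1// ltW.
  apply: (@le_trans _ _ B); last by rewrite ler_peMl//; lra.
  apply: le_trans rB.
  rewrite lerBlDr -div1r ler_pdivrMr//.
  have : (rho ^+ 2 + 1) * (1 - rho ^+ 2 / 6) <= (rho ^+ 2 + 1) * k.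
    by rewrite ler_wpM2l//; have := sqr_ge0 rho; lra.
  have := sqr_ge0 rho; nra.
have {}low := low (ltW r1).
have rB : rho `^ (1 - beta) <= B.
  have [e1|e1] := lerP 1 eta.
    apply: le_trans (B2 e1); rewrite -(powR_mulrn 2 (ltW rho0)).
    by rewrite ler_powR ?(ltW r1)//; lra.
  by rewrite (B1 (ltW e1)) ler_powR ?(ltW r1)//; lra.
apply: (@le_trans _ _ k^-1); first by rewrite gerBl.
apply: (@le_trans _ _ (c0^-1 * rho `^ (1 - beta))).
  rewrite -[1 - beta]opprB powRN -invfM lef_pV2 ?posrE// mulr_gt0// powR_gt0//.
by apply: ler_pM => //; [exact: ltW|exact: powR_ge0|lra].
Qed.

End symbol_errors.

(** * One Fourier mode of the Stokes systems *)

Local Open Scope complex_scope.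

Section stokes_modes.
Context {R : realType} {d : nat}.

Lemma sqr_normc (z : R[i]) : Normc.normc z ^+ 2 = complex.Re z ^+ 2 + complex.Im z ^+ 2.
Proof. by case: z => a b /=; rewrite sqr_sqrtr// addr_ge0 ?sqr_ge0. Qed.

Section real_mode.
Variables (b F a : 'I_d -> R) (alpha q : R).
Hypothesis FE : forall j, F j = alpha * a j + b j * q.
Hypothesis b_a : \sum_j b j * a j = 0.

Lemma mode_pressure : \sum_j b j * F j = \sum_j b j ^+ 2 * q.
Proof.
rewrite (eq_bigr (fun j => alpha * (b j * a j) + b j ^+ 2 * q)); last first.
  by move=> j _; rewrite FE; ring.
by rewrite big_split /= -mulr_sumr b_a mulr0 add0r.
Qed.

(** The two parts of F are orthogonal because the divergence of a vanishes. *)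
Lemma mode_pythagoras :
  \sum_j F j ^+ 2 = alpha ^+ 2 * \sum_j a j ^+ 2 + (\sum_j b j ^+ 2) * q ^+ 2.
Proof.
rewrite (eq_bigr (fun j => alpha ^+ 2 * a j ^+ 2 +
   (2 * alpha * q * (b j * a j) + b j ^+ 2 * q ^+ 2))); last first.
  by move=> j _; rewrite FE; ring.
by rewrite big_split big_split /= -!mulr_sumr -mulr_suml b_a mulr0 add0r.
Qed.

End real_mode.

Lemma real_mode_comparison (xi F a a' : 'I_d -> R) (alpha alpha' kappa q q' : R) :
  0 < \sum_j xi j ^+ 2 -> kappa != 0 ->
  (forall j, F j = alpha * a j + xi j * q) -> \sum_j xi j * a j = 0 ->
  (forall j, F j = alpha' * a' j + kappa * xi j * q') ->
  \sum_j kappa * xi j * a' j = 0 ->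
  kappa * q' = q /\ forall j, alpha' * a' j = alpha * a j.
Proof.
move=> x0 k0 FE ort FE' ort'.
have {}ort' : \sum_j xi j * a' j = 0.
  apply: (mulfI k0); rewrite mulr0 mulr_sumr -[RHS]ort'.
  by apply: eq_bigr => j _; rewrite mulrA.
have {}FE' j : F j = alpha' * a' j + xi j * (kappa * q') by rewrite FE'; ring.
have qq : kappa * q' = q.
  have := mode_pressure FE ort; rewrite (mode_pressure FE' ort') -!mulr_suml.
  by move/(mulfI (lt0r_neq0 x0)).
split => // j; have := FE j; rewrite FE' qq; exact: addIr.
Qed.

(** The imaginary unit exchanges the real and imaginary parts of the pressure, so
  that a complex mode is a pair of real ones. *)
Lemma mode_parts (nu L : R) (b : 'I_d -> R) (f u : 'I_d -> R[i]) (p : R[i]) :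
  (forall j, - (nu%:C * (- L%:C * u j)) + 'i * (b j)%:C * p = f j) ->
  - ('i * \sum_j (b j)%:C * u j) = 0 ->
  [/\ forall j, complex.Re (f j) = nu * L * complex.Re (u j) + b j * - complex.Im p,
      forall j, complex.Im (f j) = nu * L * complex.Im (u j) + b j * complex.Re p,
      \sum_j b j * complex.Re (u j) = 0 &
      \sum_j b j * complex.Im (u j) = 0].
Proof.
move=> H D.
have S : \sum_j (b j)%:C * u j = 0.
  move/eqP: D; rewrite oppr_eq0 mulf_eq0 => /orP[|/eqP//].
  by rewrite eq_complex /= oner_eq0 andbF.
split => [j|j||].
- rewrite -H; case: (u j) => ur ui; case: p {H} => pr pi /=; ring.
- rewrite -H; case: (u j) => ur ui; case: p {H} => pr pi /=; ring.
- have E := congr1 (@complex.Re R) S; rewrite raddf_sum in E; rewrite -[RHS]E.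
  by apply: eq_bigr => j _; case: (u j) => ur ui /=; ring.
- have E := congr1 (@complex.Im R) S; rewrite raddf_sum in E; rewrite -[RHS]E.
  by apply: eq_bigr => j _; case: (u j) => ur ui /=; ring.
Qed.

(** The solutions of the two systems are proportional: u' = (x / L) u and
  p' = p / kappa; the bounds on u and p themselves come from
  [mode_pythagoras]. *)
Lemma mode_comparison (nu x L kappa : R) (xi : 'I_d -> R)
    (f u u' : 'I_d -> R[i]) (p p' : R[i]) :
  0 < nu -> x = \sum_j xi j ^+ 2 -> 0 < x -> 0 < L -> 0 < kappa ->
  (forall j, - (nu%:C * (- x%:C * u j)) + 'i * (xi j)%:C * p = f j) ->
  - ('i * \sum_j (xi j)%:C * u j) = 0 ->
  (forall j, - (nu%:C * (- L%:C * u' j)) + 'i * (kappa * xi j)%:C * p' = f j) ->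
  - ('i * \sum_j (kappa * xi j)%:C * u' j) = 0 ->
  (nu * x) ^+ 2 * \sum_j Normc.normc (u' j - u j) ^+ 2 <=
    (x / L - 1) ^+ 2 * \sum_j Normc.normc (f j) ^+ 2 /\
  x * Normc.normc (p' - p) ^+ 2 <=
    (kappa^-1 - 1) ^+ 2 * \sum_j Normc.normc (f j) ^+ 2.
Proof.
move=> nu0 xE x0 L0 k0 Hl Dl Hn Dn.
have [Rl Il DRl DIl] := mode_parts Hl Dl.
have [Rn In DRn DIn] := mode_parts Hn Dn.
have x0' : 0 < \sum_j xi j ^+ 2 by rewrite -xE.
have [qR aR] := real_mode_comparison x0' (lt0r_neq0 k0) Rl DRl Rn DRn.
have [qI aI] := real_mode_comparison x0' (lt0r_neq0 k0) Il DIl In DIn.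
have PR := mode_pythagoras Rl DRl; have PI := mode_pythagoras Il DIl.
rewrite -xE in PR PI.
have scal (s t : R) : nu * L * s = nu * x * t -> s = x / L * t.
  move=> E; apply: (mulfI (lt0r_neq0 (mulr_gt0 nu0 L0))).
  by rewrite E; field; rewrite gt_eqF.
have nE : \sum_j Normc.normc (f j) ^+ 2 =
    \sum_j complex.Re (f j) ^+ 2 + \sum_j complex.Im (f j) ^+ 2.
  by rewrite -big_split; apply: eq_bigr => j _; rewrite sqr_normc.
have uE : \sum_j Normc.normc (u' j - u j) ^+ 2 = (x / L - 1) ^+ 2 *
    (\sum_j complex.Re (u j) ^+ 2 + \sum_j complex.Im (u j) ^+ 2).
  rewrite -big_split mulr_sumr; apply: eq_bigr => j _; rewrite sqr_normc !raddfB /=.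
  by rewrite (scal _ _ (aR j)) (scal _ _ (aI j)); ring.
have pE : Normc.normc (p' - p) ^+ 2 = (kappa^-1 - 1) ^+ 2 *
    ((- complex.Im p) ^+ 2 + complex.Re p ^+ 2).
  rewrite sqr_normc !raddfB /=.
  have -> : complex.Re p' = kappa^-1 * complex.Re p by rewrite -qI mulKf// gt_eqF.
  have -> : complex.Im p' = kappa^-1 * complex.Im p.
    apply: oppr_inj; rewrite -mulrN -qR mulrN mulrN mulKf// gt_eqF//.
  ring.
have sq (g : 'I_d -> R) : 0 <= \sum_j g j ^+ 2 by apply: sumr_ge0 => j _; exact: sqr_ge0.
rewrite uE pE nE PR PI; split.
- rewrite mulrCA ler_wpM2l ?sqr_ge0//.
  have := mulr_ge0 (ltW x0) (sqr_ge0 (- complex.Im p)).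
  have := mulr_ge0 (ltW x0) (sqr_ge0 (complex.Re p)).
  lra.
- rewrite mulrCA ler_wpM2l ?sqr_ge0//.
  have := mulr_ge0 (sqr_ge0 (nu * x)) (sq (fun j => complex.Re (u j))).
  have := mulr_ge0 (sqr_ge0 (nu * x)) (sq (fun j => complex.Im (u j))).
  lra.
Qed.

End stokes_modes.

(** * Sobolev norms and the error estimate *)

Section sobolev_norms.
Context {R : realType} {d : nat}.

Lemma esum_le_scale (T : choiceType) (I : set T) (a b : T -> \bar R) (k : R) :
  0 <= k -> (forall i, 0 <= b i)%E -> (forall i, I i -> a i <= k%:E * b i)%E ->
  (\esum_(i in I) a i <= k%:E * \esum_(i in I) b i)%E.
Proof.
move=> k0 b0 ab; apply: ge_ereal_sup => _ [X IX <-].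
apply: (@le_trans _ _ (k%:E * \sum_(i \in X) b i)%E).
  rewrite ge0_mule_fsumr//; case: IX => finX XI.
  by apply: lee_fsum => // t /XI /ab.
by rewrite lee_wpmul2l ?lee_fin//; apply: esum_ge; exists X.
Qed.

Lemma sqrt_esum_le (T : choiceType) (I : set T) (a b : T -> R) (c k : R) :
  0 <= c -> 0 <= k -> (forall i, 0 <= a i) -> (forall i, 0 <= b i) ->
  (forall i, I i -> a i <= k ^+ 2 * b i) ->
  ((c%:E * \esum_(i in I) (a i)%:E) `^ 2^-1 <=
   k%:E * (c%:E * \esum_(i in I) (b i)%:E) `^ 2^-1)%E.
Proof.
move=> c0 k0 a0 b0 ab.
have A0 : (0 <= \esum_(i in I) (a i)%:E)%E by apply: esum_ge0 => i _; rewrite lee_fin.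
have B0 : (0 <= \esum_(i in I) (b i)%:E)%E by apply: esum_ge0 => i _; rewrite lee_fin.
have -> : k%:E = ((k ^+ 2)%:E `^ 2^-1)%E.
  by rewrite poweR_EFin powR12_sqrt ?sqr_ge0// sqrtr_sqr ger0_norm.
rewrite -poweRM ?lee_fin ?sqr_ge0 ?mule_ge0 ?lee_fin//.
apply: gt0_ler_poweR; rewrite ?in_itv /= ?leey ?andbT ?mule_ge0 ?lee_fin ?sqr_ge0//.
rewrite muleCA lee_wpmul2l ?lee_fin//.
by apply: esum_le_scale; rewrite ?sqr_ge0// => i Ii; rewrite lee_fin// ab.
Qed.

Lemma Hs_vnormE s (u : vector_coefs R d) : Hs_vnorm s u =
  ((((2 * pi) ^+ d)^-1%:E * \esum_(xi in [set xi : freq d | xi != 0%R])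
     (wavenumber xi `^ (2 * s) * \sum_j Normc.normc (u xi j 0) ^+ 2)%:E) `^ 2^-1)%E.
Proof.
have c0 : 0 <= ((2 * pi) ^+ d)^-1 :> R.
  by rewrite invr_ge0 exprn_ge0// mulr_ge0// pi_ge0.
rewrite /Hs_vnorm; congr (_ `^ _)%E; rewrite /Hs_norm2 -ge0_sume_distrr; last first.
  by move=> j _; apply: esum_ge0 => xi _; rewrite lee_fin mulr_ge0 ?powR_ge0 ?sqr_ge0.
congr (_ * _)%E; rewrite -esum_sum; last first.
  by move=> xi j _ _; rewrite lee_fin mulr_ge0 ?powR_ge0 ?sqr_ge0.
by apply: eq_esum => xi _; rewrite sumEFin -mulr_sumr.
Qed.

Lemma Hs_vnorm_le s s' (u f : vector_coefs R d) k : 0 <= k ->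
  (forall xi, xi != 0 ->
    wavenumber xi `^ (2 * s) * \sum_j Normc.normc (u xi j 0) ^+ 2 <=
    k ^+ 2 * (wavenumber xi `^ (2 * s') * \sum_j Normc.normc (f xi j 0) ^+ 2)) ->
  (Hs_vnorm s u <= k%:E * Hs_vnorm s' f)%E.
Proof.
move=> k0 H; rewrite !Hs_vnormE; apply: sqrt_esum_le => //.
- by rewrite invr_ge0 exprn_ge0// mulr_ge0// pi_ge0.
- by move=> xi; rewrite mulr_ge0 ?powR_ge0// sumr_ge0// => j _; exact: sqr_ge0.
- by move=> xi; rewrite mulr_ge0 ?powR_ge0// sumr_ge0// => j _; exact: sqr_ge0.
Qed.

Lemma Hs_norm_le s s' (p : scalar_coefs R d) (f : vector_coefs R d) k : 0 <= k ->
  (forall xi, xi != 0 ->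
    wavenumber xi `^ (2 * s) * Normc.normc (p xi) ^+ 2 <=
    k ^+ 2 * (wavenumber xi `^ (2 * s') * \sum_j Normc.normc (f xi j 0) ^+ 2)) ->
  (Hs_norm s p <= k%:E * Hs_vnorm s' f)%E.
Proof.
move=> k0 H; rewrite Hs_vnormE; apply: sqrt_esum_le => //.
- by rewrite invr_ge0 exprn_ge0// mulr_ge0// pi_ge0.
- by move=> xi; rewrite mulr_ge0 ?powR_ge0 ?sqr_ge0.
- by move=> xi; rewrite mulr_ge0 ?powR_ge0// sumr_ge0// => j _; exact: sqr_ge0.
Qed.

Lemma truncateB (V : zmodType) (N : R) (g h : freq d -> V) (xi : freq d) :
  (truncate N g - truncate N h)%R xi =
  if wavenumber xi <= N then g xi - h xi else 0.
Proof.
rewrite -[LHS]/(truncate N g xi - truncate N h xi) /truncate.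
by case: ifP => // _; rewrite subrr.
Qed.

End sobolev_norms.

Theorem theorem17 (R : realType) (nu : R) (d : nat) (omega omegah : R -> R)
    (beta : R) (nu_gt0 : 0 < nu) (d23 : d = 2%N \/ d = 3%N)
    (Hker : kernel_assumptions d omega omegah beta) :
  exists C : R, forall (delta N : R) (f : vector_coefs R d)
    (u : vector_coefs R d) (p : scalar_coefs R d)
    (ud : vector_coefs R d) (pd : scalar_coefs R d),
    0 < delta -> 1 <= N ->
    mean_zero_vdistr f ->
    local_stokes nu f u p ->
    nonlocal_stokes omega omegah delta nu f ud pd ->
    (L2_vnorm (truncate N ud - truncate N u)%R
       <= (C * delta ^+ 2)%:E * L2_vnorm (truncate N f))%E /\
    (forall eta : R, - beta <= eta ->
      (L2_norm (truncate N pd - truncate N p)%R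
         <= (C * delta `^ Num.min 2 (1 + eta))%:E
            * Hs_vnorm eta (truncate N f))%E).
Proof.
have d2 : (2 <= d)%N by case: d23 => ->.
have [C0 HC0] := gradient_factor_error d2 Hker.
(* The two summands serve the velocity and the pressure estimates. *)
pose C := 5 / nu + `|C0|.
have C1 : 5 / nu <= C by rewrite lerDl.
have C2 : C0 <= C by apply: le_trans (ler_norm _) _; rewrite lerDr divr_ge0// ltW.
have Cpos : 0 <= C by rewrite addr_ge0// divr_ge0// ltW.
exists C => delta N f u p ud pd delta0 _ _ [_ _ Hl Dl] [_ _ Hn Dn].
have mode xi : xi != 0 -> let F := \sum_j Normc.normc (f xi j 0) ^+ 2 in
    \sum_j Normc.normc (ud xi j 0 - u xi j 0) ^+ 2 <= (C * delta ^+ 2) ^+ 2 * F /\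
    (forall eta, - beta <= eta -> Normc.normc (pd xi - p xi) ^+ 2 <=
      (C * delta `^ Num.min 2 (1 + eta)) ^+ 2 * (wavenumber xi `^ (2 * eta) * F)).
  move=> xi0 F.
  have [L0 Lerr] := lambda_error d2 Hker delta0 xi0.
  have [k0 kerr] := HC0 delta xi delta0 xi0.
  have w1 : 1 <= wavenumber xi :> R := wavenumber_ge1 xi0.
  set L := lambda_symbol _ _ _ in L0 Lerr.
  set k := gradient_factor _ _ _ in k0 kerr.
  set x := wavenumber xi ^+ 2 in Lerr.
  have x0 : 0 < x by rewrite exprn_gt0//; lra.
  have F0 : 0 <= F by apply: sumr_ge0 => j _; exact: sqr_ge0.
  have xE : x = \sum_(j < d) ((xi 0 j)%:~R : R) ^+ 2.
    rewrite /x sqr_wavenumber; apply: eq_bigr => j _.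
    by rewrite tnth_wave -expr2.
  (* Both systems restricted to the mode xi, with symbols x, L and xi, k xi. *)
  have [] := @mode_comparison R d nu x L k (fun j => (xi 0 j)%:~R)
    (fun j => f xi j 0) (fun j => u xi j 0) (fun j => ud xi j 0) (p xi) (pd xi)
    nu_gt0 xE x0 L0 k0.
  - by move=> j; rewrite -Hl !mxE.
  - by rewrite -[RHS](Dl xi); congr (- ('i * _)); apply: eq_bigr => j _; rewrite mxE.
  - move=> j; rewrite -Hn -(b_symbol_parallel d2 Hker j delta0 xi0) !mxE//.
  - rewrite -[RHS](Dn xi); congr (- ('i * _)); apply: eq_bigr => j _.
    by rewrite -(b_symbol_parallel d2 Hker j delta0 xi0).
  rewrite -/F => Hu Hp; split.
    have nx0 : 0 < (nu * x) ^+ 2 by rewrite exprn_gt0// mulr_gt0.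
    rewrite -(ler_pM2l nx0); apply: le_trans Hu _.
    rewrite mulrA -exprMn ler_wpM2r// -real_normK ?num_real//.
    have nxC : 0 <= nu * x * (C * delta ^+ 2).
      apply: mulr_ge0; first exact: ltW (mulr_gt0 nu_gt0 x0).
      by rewrite mulr_ge0// sqr_ge0.
    rewrite ler_pXn2r ?nnegrE//.
    apply: le_trans Lerr _.
    have -> : 5 * delta ^+ 2 * x = nu * x * (5 / nu * delta ^+ 2).
      by field; rewrite gt_eqF.
    apply: ler_wpM2l; first by rewrite mulr_ge0// ltW.
    by apply: ler_wpM2r => //; exact: sqr_ge0.
  move=> eta eta_b; have {}kerr := kerr eta eta_b.
  have w0 : 0 < wavenumber xi :> R := lt_le_trans ltr01 w1.
  rewrite -(ler_pM2l x0); apply: le_trans Hp _.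
  rewrite (mulrA _ _ F) (mulrA x) ler_wpM2r// -real_normK ?num_real//.
  rewrite [2 * eta]mulrC powRrM (powR_mulrn 2) ?powR_ge0// /x -!exprMn.
  rewrite ler_pXn2r ?nnegrE ?mulr_ge0 ?powR_ge0 ?(ltW w0)//.
  apply: le_trans kerr _.
  rewrite powRD ?(gt_eqF w0) ?implybT// powRr1 ?(ltW w0)//.
  rewrite [leRHS](_ : _ = C * (delta `^ Num.min 2 (1 + eta) * (wavenumber xi * wavenumber xi `^ eta))); last by ring.
  by rewrite ler_wpM2r// !mulr_ge0 ?powR_ge0 ?(ltW w0).
have normc0 : Normc.normc (0 : R[i]) = 0 by rewrite /= expr0n addr0 sqrtr0.
split => [|eta eta_b].
  apply: Hs_vnorm_le => [|xi xi0]; first by apply: mulr_ge0 => //; exact: sqr_ge0.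
  rewrite mulr0 powRr0 !mul1r truncateB /truncate; case: ifP => _.
    by under eq_bigr do rewrite !mxE; have [] := mode xi xi0.
  rewrite [leLHS]big1 => [|j _]; last by rewrite mxE normc0 expr0n.
  by apply: mulr_ge0; [exact: sqr_ge0|apply: sumr_ge0 => j _; exact: sqr_ge0].
apply: Hs_norm_le => [|xi xi0]; first by rewrite mulr_ge0 ?powR_ge0.
rewrite mulr0 powRr0 !mul1r truncateB /truncate; case: ifP => _.
  by have [_] := mode xi xi0; exact.
rewrite normc0 expr0n; apply: mulr_ge0; first exact: sqr_ge0.
by rewrite mulr_ge0 ?powR_ge0// sumr_ge0// => j _; exact: sqr_ge0.
Qed.
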